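(* Let $\mathcal{R}$ be a translation-invariant ergodic point process on $\mathbb{R}^d$ with finite, positive intensity that almost surely is non-equidistant and has no descending chains. If $\mathcal{R}$ is insertion-tolerant or deletion-tolerant, then the one-colour stable matching scheme of $\mathcal{R}$ satisfies $\mathbb{E}^*X^d=\infty$, where $X$ is a random variable with distribution function $\mathbb{P}^*(X\le r)=F(r)$, $r\ge0$, with $F$ the distribution function of the typical matching distance.
   Context: Point processes are always simple and locally finite, i.e. random elements of the space $\mathbb{M}$ of simple locally finite point measures on $\mathbb{R}^d$, equipped with the $\sigma$-field generated by the evaluations $\mu\mapsto\mu(A)$, $A$ Borel. The support of $\mu\in\mathbb{M}$ is $[\mu]=\{y:\mu(\{y\})=1\}$. A point process is translation-invariant if its law is invariant under all translations of $\mathbb{R}^d$, and ergodic if moreover every translation-invariant event has probability $0$ or $1$. The intensity is $\mathbb{E}\,\mathcal{R}([0,1]^d)$. $\|\cdot\|$ is the Euclidean norm. For random variables $X,Y$ with values in the same measurable space, $X\prec Y$ means that $\mathbb{P}(Y\in\mathcal{A})=0$ implies $\mathbb{P}(X\in\mathcal{A})=0$ for all measurable $\mathcal{A}$. A point process $\Pi$ is insertion-tolerant if for every Borel set $S\subseteq\mathbb{R}^d$ with Lebesgue measure in $(0,\infty)$, if $U$ is uniformly distributed on $S$ and independent of $\Pi$, then $\Pi+\delta_U\prec\Pi$, where $\delta_x$ is the point measure at $x$. A $\Pi$-point is an $\mathbb{R}^d$-valued random variable $Z$ with $Z\in[\Pi]$ almost surely; $\Pi$ is deletion-tolerant if $\Pi-\delta_Z\prec\Pi$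 for every $\Pi$-point $Z$. $\mu\in\mathbb{M}$ has a descending chain if there exist $x_1,x_2,\ldots\in[\mu]$ with $\|x_{i-1}-x_i\|>\|x_i-x_{i+1}\|$ for all $i$. $\mu$ is non-equidistant if for all $x,y,u,v\in[\mu]$ with $\{x,y\}\ne\{u,v\}$ and $x\neq y$ we have $\|x-y\|\neq\|u-v\|$. A one-colour matching scheme for $\mathcal{R}$ is a point process $\mathcal{M}$ of unordered pairs $\{x,y\}\subset\mathbb{R}^d$ such that almost surely $[\mathcal{M}]$ is the edge set of a simple graph with vertex set $[\mathcal{R}]$ in which every vertex has degree exactly one; write $\mathcal{M}(x)=y$ iff $\{x,y\}\in[\mathcal{M}]$. It is stable if almost surely there do not exist distinct $x,y\in[\mathcal{R}]$ with $\|x-y\|<\min\{\|x-\mathcal{M}(x)\|,\|y-\mathcal{M}(y)\|\}$. For $\mathcal{R}$ translation-invariant of finite intensity, almost surely non-equidistant and without descending chains, it is known that a one-colour stable matching scheme exists (as an isometry-equivariant factor of $\mathcal{R}$, obtained by iteratively matching and removing mutually closest pairs) and that any two agree almost surely; this is ''the'' one-colour stable matching scheme $\mathcal{M}$. Define $$F(r)=\big(\mathbb{E}\,\mathcal{R}([0,1)^d)\big)^{-1}\,\mathbb{E}\,\#\{x\in[\mathcal{R}]\cap[0,1)^d:\ \|x-\mathcal{M}(x)\|\le r\},$$ and let $X$ be a random variable with probability measure $\mathbb{P}^*$ and expectation $\mathbb{E}^*$ such that $\mathbb{P}^*(X\le r)=F(r)$ for all $r\ge0$. *)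

(* Defs.v *)
From HB Require Import structures.
From mathcomp Require Import all_boot all_order all_algebra.
From mathcomp Require Import all_classical all_reals all_analysis.
From mathcomp Require Import measurable_realfun.

Set Implicit Arguments.
Unset Strict Implicit.
Unset Printing Implicit Defensive.

Import Order.TTheory GRing.Theory Num.Theory.
Import numFieldNormedType.Exports.

Local Open Scope classical_set_scope.
Local Open Scope ring_scope.

(* Row vectors with their product topology and Borel sigma-algebra.  The
   library norm on this type is the sup norm; the Euclidean norm is [enorm]
   below. *)
Definition Rd (R : realType) (n : nat) : Type := 'rV[R]_n.

HB.instance Definition _ R n := NormedModule.on (Rd R n).

Definition Rd_display : measure_display.
Proof. by constructor. Qed.

Section Rd_borel.
Context (R : realType) (n : nat).

Definition Rd_borel : set (set (Rd R n)) := <<s @open (Rd R n) >>.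

Lemma Rd_borel0 : Rd_borel set0.
Proof. exact: sigma_algebra0. Qed.

Lemma Rd_borelC (A : set (Rd R n)) : Rd_borel A -> Rd_borel (~` A).
Proof. exact: sigma_algebraC. Qed.

Lemma Rd_borelU (F : (set (Rd R n))^nat) :
  (forall i, Rd_borel (F i)) -> Rd_borel (\bigcup_i F i).
Proof. exact: sigma_algebra_bigcup. Qed.

End Rd_borel.

HB.instance Definition _ R n :=
  @isMeasurable.Build Rd_display (Rd R n) (@Rd_borel R n)
    (@Rd_borel0 R n) (@Rd_borelC R n) (@Rd_borelU R n).

Section Rd_measurability.
Context (R : realType) (n : nat).

Lemma open_measurable_Rd (A : set (Rd R n)) : open A -> measurable A.
Proof. exact: sub_sigma_algebra. Qed.

Lemma continuous_measurable_Rd (m : nat) (f : Rd R n -> Rd R m) :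
  continuous f -> measurable_fun setT f.
Proof.
move=> cf; apply: (@measurability _ _ _ _ _ _ (@open (Rd R m))) => //.
move=> _ [U oU <-]; rewrite setTI; apply: open_measurable_Rd.
by move/continuousP : cf; apply.
Qed.

Lemma measurable_Rd_coord (i : 'I_n) :
  measurable_fun setT (fun x : Rd R n => x ord0 i : R).
Proof.
apply: (measurability _ (RGenOpens.measurableE R)).
move=> _ [_ [a [b ->]] <-]; rewrite setTI; apply: open_measurable_Rd.
have /continuousP := @coord_continuous R 1 n ord0 i.
by apply; exact: interval_open.
Qed.

Let box (ab : 'rV[rat]_n * 'rV[rat]_n) : set (Rd R n) :=
  [set x | forall i, ratr (ab.1 ord0 i) < x ord0 i < ratr (ab.2 ord0 i)].

Lemma measurable_fun_Rd d (T : measurableType d) (f : T -> Rd R n) :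
  (forall i, measurable_fun setT (fun t => f t ord0 i : R)) ->
  measurable_fun setT f.
Proof.
move=> mf; apply: (@measurability _ _ _ _ _ _ (@open (Rd R n))) => //.
move=> _ [U oU <-]; rewrite setTI.
have mbox ab : measurable (f @^-1` box ab).
  rewrite [X in measurable X](_ : _ = \bigcap_(i in [set: 'I_n])
    ((fun t => f t ord0 i : R) @^-1`
      `]ratr (ab.1 ord0 i), ratr (ab.2 ord0 i)[%classic)).
    apply: fin_bigcap_measurable => // i _.
    by rewrite -[X in measurable X]setTI; exact: mf.
  apply/seteqP; split => [t ft i _ /=|t ft i]; first by rewrite in_itv/= ft.
  by have := ft i I; rewrite /= in_itv.
rewrite [X in measurable X](_ : _ = \bigcup_ab
    (if `[< box ab `<=` U >] then f @^-1` box ab else set0)); last first.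
  apply/seteqP; split => [t Ut|t [ab _]]; last first.
    by case: ifPn => // /asboolP abU /= /abU.
  have /nbhs_ballP[e /= e0 eU] : nbhs (f t) U by exact: open_nbhs_nbhs.
  have /choice[a ha] i : exists q : rat,
      (ratr q : R) \in `](f t ord0 i - e), (f t ord0 i)[.
    by apply: rat_in_itvoo; rewrite ltrBlDr ltrDl.
  have /choice[b hb] i : exists q : rat,
      (ratr q : R) \in `](f t ord0 i), (f t ord0 i + e)[.
    by apply: rat_in_itvoo; rewrite ltrDl.
  exists (\row_i a i, \row_i b i) => //.
  rewrite asboolT.
    move=> i /=; rewrite !mxE.
    move: (ha i) (hb i); rewrite !in_itv/= => /andP[_ ->] /andP[-> _].
    by [].
  move=> x abx; apply: eU; split => // k i; rewrite (ord1 k).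
  move: (ha i) (hb i) (abx i); rewrite /= !in_itv/= !mxE.
  move=> /andP[h1 h2] /andP[h3 h4] /andP[h5 h6].
  rewrite /ball/= distrC ltr_distl; apply/andP; split.
    exact: lt_trans h1 h5.
  exact: lt_trans h6 h4.
apply: countable_bigcupT_measurable; first exact: countableP.
by move=> ab; case: ifP.
Qed.

End Rd_measurability.

Section lebesgue_Rd.
Context (R : realType).

Definition Rd_cons n (xv : measurableTypeR R * Rd R n) : Rd R n.+1 :=
  row_mx (\row_(_ < 1) xv.1) xv.2.

Lemma measurable_Rd_cons n : measurable_fun setT (@Rd_cons n).
Proof.
apply: measurable_fun_Rd => i.
case: (@split_ordP 1 n i) => j ->.
  rewrite [X in measurable_fun _ X](_ : _ = fst); first exact: measurable_fst.
  by apply/funext => xv; rewrite /Rd_cons (@row_mxEl _ 1 1 n) mxE.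
rewrite [X in measurable_fun _ X](_ : _ = (fun v : Rd R n => v ord0 j) \o snd).
  exact: measurableT_comp (measurable_Rd_coord j) measurable_snd.
by apply/funext => xv; rewrite /Rd_cons (@row_mxEr _ 1 1 n).
Qed.

Definition Rd_uncons n (v : Rd R n.+1) : measurableTypeR R * Rd R n :=
  (v ord0 ord0, \row_j v ord0 (rshift 1 j)).

Lemma measurable_Rd_uncons n : measurable_fun setT (@Rd_uncons n).
Proof.
apply/measurable_fun_pairP; split; first exact: measurable_Rd_coord.
apply: measurable_fun_Rd => j.
rewrite [X in measurable_fun _ X](_ : _ =
  (fun v : Rd R n.+1 => v ord0 (rshift 1 j))).
  exact: measurable_Rd_coord.
by apply/funext => v /=; rewrite mxE.
Qed.

Lemma Rd_consK n : cancel (@Rd_cons n) (@Rd_uncons n).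
Proof.
case=> x v; rewrite /Rd_uncons /Rd_cons; congr pair.
  have -> : ord0 = lshift n ord0 :> 'I_(1 + n) by exact: val_inj.
  by rewrite (@row_mxEl _ 1 1 n) mxE.
by apply/rowP => j; rewrite mxE (@row_mxEr _ 1 1 n).
Qed.

End lebesgue_Rd.

Section lebesgue_Rd_succ.
Local Open Scope ereal_scope.
Context (R : realType) (n : nat).
Variable m : {sigma_finite_measure set (Rd R n) -> \bar R}.

Definition lebesgue_Rd_succ : set (Rd R n.+1) -> \bar R :=
  pushforward (lebesgue_measure \x m) (@Rd_cons R n).

Let mcons := @measurable_Rd_cons R n.

Let succ0 : lebesgue_Rd_succ set0 = 0.
Proof. exact: measure0. Qed.

Let succ_ge0 A : 0 <= lebesgue_Rd_succ A.
Proof. exact: measure_ge0. Qed.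

Let succ_sigma_additive : semi_sigma_additive lebesgue_Rd_succ.
Proof. exact: measure_semi_sigma_additive. Qed.

HB.instance Definition _ := isMeasure.Build _ _ _ lebesgue_Rd_succ
  succ0 succ_ge0 succ_sigma_additive.

Let succ_sigma_finite : sigma_finite setT lebesgue_Rd_succ.
Proof.
have [F FT Foo] : sigma_finite setT (lebesgue_measure \x m).
  have /sigma_finiteP[F [TF ndF Foo]] :=
    sigma_finiteT (@lebesgue_measure R).
  have /sigma_finiteP[G [TG ndG Goo]] := sigma_finiteT m.
  exists (fun k => F k `*` G k).
    rewrite -setXTT TF TG predeqE => -[x y]; split => [[/= [k _ Fx] [l _ Gy]]|].
      exists (maxn k l) => //; split.
        by move: x Fx; exact/subsetPset/ndF/leq_maxl.
      by move: y Gy; exact/subsetPset/ndG/leq_maxr.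
    by move=> [k _ []/= ? ?]; split; exists k.
  move=> k; have [? ?] := Foo k; have [? ?] := Goo k.
  split; first exact: measurableX.
  by rewrite product_measure1E// lte_mul_pinfty// ge0_fin_numE.
exists (fun k => @Rd_uncons R n @^-1` F k).
  by rewrite -preimage_bigcup -FT preimage_setT.
move=> k; have [mF Fk] := Foo k; split.
  by rewrite -[X in measurable X]setTI; exact: measurable_Rd_uncons.
rewrite /lebesgue_Rd_succ /pushforward -comp_preimage.
rewrite (_ : _ \o _ = id) ?preimage_id//.
by apply/funext => xv /=; rewrite Rd_consK.
Qed.

HB.instance Definition _ := Measure_isSigmaFinite.Build _ _ _ lebesgue_Rd_succ
  succ_sigma_finite.

End lebesgue_Rd_succ.

(* Lebesgue measure on R^(n+1) as the product of Lebesgue measure on R and on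
   R^n, transported along [Rd_cons]. *)
Fixpoint lebesgue_Rd (R : realType) (n : nat) :
    {sigma_finite_measure set (Rd R n) -> \bar R} :=
  match n with
  | 0 => \d_(0 : Rd R 0)
  | n'.+1 => lebesgue_Rd_succ (lebesgue_Rd R n')
  end.

Definition enorm (R : realType) (n : nat) (x : Rd R n) : R :=
  Num.sqrt (\sum_(i < n) x ord0 i ^+ 2).

(* The space of all measures on [T] with the sigma-algebra generated by the
   evaluations [mu |-> mu A], [A] measurable.  Measures that agree on measurable
   sets belong to the same events.  Point processes are random elements of this
   space with values in the simple locally finite point measures. *)
Definition measures d (T : measurableType d) (R : realType) : Type :=
  {measure set T -> \bar R}.

Definition measures_display : measure_display -> measure_display.
Proof. by []. Qed.

Section measures.
Context d (T : measurableType d) (R : realType).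

HB.instance Definition _ := gen_eqMixin (measures T R).
HB.instance Definition _ := gen_choiceMixin (measures T R).
HB.instance Definition _ := isPointed.Build (measures T R) mzero.

Definition measures_measurable : set (set (measures T R)) :=
  <<s \bigcup_(A in measurable)
        preimage_set_system setT (fun mu : measures T R => mu A) measurable >>.

Let measures0 : measures_measurable set0.
Proof. exact: sigma_algebra0. Qed.

Let measuresC (A : set (measures T R)) :
  measures_measurable A -> measures_measurable (~` A).
Proof. exact: sigma_algebraC. Qed.

Let measuresU (F : (set (measures T R))^nat) :
  (forall i, measures_measurable (F i)) -> measures_measurable (\bigcup_i F i).
Proof. exact: sigma_algebra_bigcup. Qed.

HB.instance Definition _ :=
  @isMeasurable.Build (measures_display d) (measures T R) measures_measurable
    measures0 measuresC measuresU.

End measures.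

Section unordered_pairs.
Context (R : realType) (n : nat).

Definition upair : Type :=
  {e : set (Rd R n) | exists x y, e = [set x; y]}.

Definition upair_of (x y : Rd R n) : upair :=
  exist _ [set x; y] (ex_intro _ x (ex_intro _ y erefl)).

HB.instance Definition _ := gen_eqMixin upair.
HB.instance Definition _ := gen_choiceMixin upair.
HB.instance Definition _ := isPointed.Build upair (upair_of 0 0).

(* Quotient of the Borel sigma-algebra of [Rd R n * Rd R n] by swapping. *)
Definition upair_measurable : set (set upair) :=
  image_set_system setT (fun p : Rd R n * Rd R n => upair_of p.1 p.2)
    measurable.

Let upair_sigma : sigma_algebra setT upair_measurable.
Proof. exact/sigma_algebra_image/sigma_algebra_measurable. Qed.

Let upair0 : upair_measurable set0.
Proof. by case: upair_sigma. Qed.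

Let upairC (A : set upair) : upair_measurable A -> upair_measurable (~` A).
Proof. by case: upair_sigma => _ + _ => /[apply]; rewrite setTD. Qed.

Let upairU (F : (set upair)^nat) :
  (forall i, upair_measurable (F i)) -> upair_measurable (\bigcup_i F i).
Proof. by case: upair_sigma => _ _; apply. Qed.

HB.instance Definition _ :=
  @isMeasurable.Build Rd_display upair upair_measurable upair0 upairC upairU.

End unordered_pairs.

Section point_measures.
Context d (T : measurableType d) (R : realType).
Implicit Types (mu : measures T R) (K : set (set T)).

Definition support mu : set T := [set y | mu [set y] = 1%E].

(* Sums of Dirac masses at distinct points, finitely many in each member of
   [K], where [K] is the class of sets on which finiteness is required. *)
Definition simple_locally_finite K mu : Prop :=
  exists S : set T,
    (forall B, K B -> finite_set (S `&` B)) /\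
    (forall A, measurable A -> mu A = \esum_(x in S) \d_x A).

Definition point_process K dO (Omega : measurableType dO)
    (X : Omega -> measures T R) : Prop :=
  measurable_fun setT X /\ forall w, simple_locally_finite K (X w).

End point_measures.

Section laws.
Context dO (Omega : measurableType dO) dO' (Omega' : measurableType dO').
Context (R : realType) (P : probability Omega R) (P' : probability Omega' R).
Context d (T : measurableType d).

Definition same_law (X : Omega -> T) (X' : Omega' -> T) : Prop :=
  forall A : set T, measurable A -> P (X @^-1` A) = P' (X' @^-1` A).

(* X \prec Y *)
Definition law_dominated (X : Omega -> T) (Y : Omega' -> T) : Prop :=
  forall A : set T, measurable A ->
    P' (Y @^-1` A) = 0%E -> P (X @^-1` A) = 0%E.

End laws.

Definition independent dO (Omega : measurableType dO) (R : realType)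
    (P : probability Omega R) d1 (T1 : measurableType d1)
    d2 (T2 : measurableType d2) (X : Omega -> T1) (Y : Omega -> T2) : Prop :=
  forall A B, measurable A -> measurable B ->
    P (X @^-1` A `&` Y @^-1` B) = (P (X @^-1` A) * P (Y @^-1` B))%E.

Section configurations.
Context (R : realType) (n : nat).
Local Notation E := (Rd R n).

Definition point_config : set (measures E R) :=
  simple_locally_finite [set B : set E | compact B].

Definition has_descending_chain (mu : measures E R) : Prop :=
  exists x : nat -> E, (forall i, support mu (x i)) /\
    forall i, enorm (x i - x i.+1) > enorm (x i.+1 - x i.+2).

Definition non_equidistant (mu : measures E R) : Prop :=
  forall x y u v : E,
    support mu x -> support mu y -> support mu u -> support mu v ->
    [set x; y] <> [set u; v] -> x <> y ->
    enorm (x - y) <> enorm (u - v).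

Lemma measurable_shift (t : E) : measurable_fun setT (shift t : E -> E).
Proof.
apply: continuous_measurable_Rd => x; rewrite /shift.
exact: cvgD (@cvg_id _ _) (cvg_cst _).
Qed.

Section translate.
Variables (t : E) (mu : measures E R).

Definition translate_fun : set E -> \bar R :=
  pushforward mu (shift t : E -> E).

Let mshift := @measurable_shift t.

Let translate0 : translate_fun set0 = 0%E.
Proof. exact: measure0. Qed.

Let translate_ge0 A : (0 <= translate_fun A)%E.
Proof. exact: measure_ge0. Qed.

Let translate_sigma_additive : semi_sigma_additive translate_fun.
Proof. exact: measure_semi_sigma_additive. Qed.

HB.instance Definition _ := isMeasure.Build _ _ _ translate_fun
  translate0 translate_ge0 translate_sigma_additive.

Definition translate : measures E R := translate_fun.

End translate.

Definition add_point (mu : measures E R) (z : E) : measures E R :=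
  measure_add mu \d_z.

Definition unit_cube : set E := [set x | forall i, 0 <= x ord0 i <= 1].
Definition half_open_cube : set E := [set x | forall i, 0 <= x ord0 i < 1].

End configurations.

Section processes.
Context (R : realType) (n : nat).
Local Notation E := (Rd R n).
Context dO (Omega : measurableType dO) (P : probability Omega R).
Implicit Type X : Omega -> measures E R.

Definition Rd_point_process X : Prop :=
  point_process [set B : set E | compact B] X.

Definition translation_invariant X : Prop :=
  forall t, same_law P P (fun w => translate t (X w)) X.

Definition ergodic X : Prop :=
  translation_invariant X /\
  forall A : set (measures E R), measurable A ->
    (forall t mu, point_config mu -> (A (translate t mu) <-> A mu)) ->
    P (X @^-1` A) = 0%E \/ P (X @^-1` A) = 1%E.

Definition intensity X : \bar R := (\int[P]_w X w (@unit_cube R n))%E.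

Definition uniform_on (S : set E) (U : Omega -> E) : Prop :=
  forall A, measurable A ->
    P (U @^-1` A) =
      (fine (lebesgue_Rd R n (A `&` S)) / fine (lebesgue_Rd R n S))%:E.

(* [Y] is the point process obtained from [X] by subtracting the Dirac mass at
   [Z]; this determines [Y] almost surely. *)
Definition deletion_tolerant X : Prop :=
  forall Z : Omega -> E, measurable_fun setT Z ->
    {ae P, forall w, support (X w) (Z w)} ->
    forall Y : Omega -> measures E R, Rd_point_process Y ->
      {ae P, forall w, forall A, measurable A ->
        Y w A = (X w A - \d_(Z w) A)%E} ->
      law_dominated P P Y X.

End processes.

(* A uniform variable independent of [X] may require a richer probability space than the one
   carrying [X], hence the quantification over copies [Y] of [X]. *)
Definition insertion_tolerant (R : realType) (n : nat) dO
    (Omega : measurableType dO) (P : probability Omega R)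
    (X : Omega -> measures (Rd R n) R) : Prop :=
  forall S : set (Rd R n), measurable S ->
    (0 < lebesgue_Rd R n S < +oo)%E ->
    forall (dO' : measure_display) (Omega' : measurableType dO')
      (P' : probability Omega' R) (Y : Omega' -> measures (Rd R n) R)
      (U : Omega' -> Rd R n),
      Rd_point_process Y -> same_law P' P Y X ->
      measurable_fun setT U -> uniform_on P' S U -> independent P' Y U ->
      law_dominated P' P (fun w => add_point (Y w) (U w)) X.

Section matchings.
Context (R : realType) (n : nat).
Local Notation E := (Rd R n).
Implicit Types (mu : measures E R) (m : measures (upair R n) R).

Definition perfect_matching mu m : Prop :=
  (forall e, support m e -> exists x y,
      [/\ support mu x, support mu y, x <> y & e = upair_of x y]) /\
  (forall x, support mu x -> exists! e, support m e /\ sval e x).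

(* The partner [y] of [x], i.e. [{x, y}] is an edge; [0] if there is none. *)
Definition partner m (x : E) : E := xget 0 [set y | support m (upair_of x y)].

Definition matching_distance m (x : E) : R := enorm (x - partner m x).

Definition stable_matching mu m : Prop :=
  ~ exists x y, [/\ support mu x, support mu y, x <> y &
      enorm (x - y) < Num.min (matching_distance m x) (matching_distance m y)].

Context dO (Omega : measurableType dO) (P : probability Omega R).
Variables (X : Omega -> measures E R) (M : Omega -> measures (upair R n) R).

(* Locally finite here: finitely many pairs inside each compact set. *)
Definition matching_scheme : Prop :=
  point_process
    [set D : set (upair R n) |
      exists2 B : set E, compact B & D = [set e : upair R n | sval e `<=` B]] M /\
  {ae P, forall w, perfect_matching (X w) (M w)}.

Definition stable_matching_scheme : Prop :=
  matching_scheme /\ {ae P, forall w, stable_matching (X w) (M w)}.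

Definition typical_distance_cdf (r : R) : R :=
  (fine (\int[P]_w X w (@half_open_cube R n)))^-1 *
  fine (\int[P]_w counting [set x : E | [/\ support (X w) x, half_open_cube x
                                      & (matching_distance (M w) x <= r)%R]]).

End matchings.

(* Main.v *)
(* The mutually-closest-pair algorithm matches a configuration completely as
   soon as a perfect stable matching exists and distances are distinct and
   without descending chains, and "every point is matched by it" is an event of
   the configuration alone, of full probability for X and hence for every point
   process whose law is dominated by that of X.

   Let y "want" the cube Q when |y - x| < |y - M(y)| for some x in Q.  By
   translation invariance the probability that a given translate k + Q contains
   a point wanting Q is at most the intensity times P*(D > |k| - 1), which is
   summable over Z^n when E* D^n is finite.  By Borel-Cantelli only finitely
   many points then want Q.  Deleting these and their partners, except for one
   point x of X in Q, or else inserting a close companion next to each of them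
   and next to each of their partners, together with one point x in Q, yields a
   configuration with a stable matching of all points but x in which nobody
   prefers x to its partner.  Such an x is never matched by the algorithm, which
   contradicts deletion- or insertion-tolerance. *)

Require Import Defs.
From HB Require Import structures.
From mathcomp Require Import all_boot all_order all_algebra.
From mathcomp Require Import all_classical all_reals all_analysis.
From mathcomp Require Import measurable_realfun zify ring lra.

Set Implicit Arguments.
Unset Strict Implicit.
Unset Printing Implicit Defensive.

Import Order.TTheory GRing.Theory Num.Theory.
Import numFieldNormedType.Exports.

Local Open Scope classical_set_scope.
Local Open Scope ring_scope.

(* [ssralg] shadows this name. *)
Local Notation support := Defs.support.

(** * Certified pairs *)

(** Only the law of [X] is known to be translation-invariant, not that of the pair of [X] and [M],
    and tolerance compares laws of configurations only. So whatever is shifted, deleted from or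
    added to must be an event of the configuration, while the matching is consulted outcome by
    outcome. Certificates translate between the two. Their completeness is used for [X] itself; for
    the modified configurations only soundness is used, so these need not inherit distinct distances
    or the absence of descending chains.

    Tolerance concerns one random point at a time, whereas a finite set depending on the
    configuration has to be removed or added. No measurable choice of this set is made. For
    deletion, the finite modifications are covered by countably many deterministic maps; for
    insertion, by conditions of positive volume, iterated. Almost surely none of them leads to an
    unmatched point, and the one that suits the given configuration is then picked pointwise.

    Inserted points cannot be placed exactly, so the insertion argument has to survive small
    displacements. This is why companions come with a margin and why competitors are taken for every
    position in the cube. *)

Section certified_pairs.
Context {R : realType} {T : choiceType} (d : T -> T -> R).
Hypothesis dC : forall x y, d x y = d y x.
Implicit Types (S U : set T) (m : T -> T).

(* Replaces the matching by a countable condition on the configuration: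
   [certified S k a b] says that the mutually-closest-pair algorithm run on [S]
   pairs [a] with [b], and that this can be seen by following at most [k]
   generations of competitors.  The comparisons [<=] make ties count against
   [a] and [b], so that soundness does not rest on distances being distinct. *)
Fixpoint certified S (k : nat) (a b : T) : Prop :=
  if k is k'.+1 then
    [/\ S a, S b, a <> b &
      forall z, S z -> z <> a -> z <> b ->
        (d a z <= d a b ->
          exists z', certified S k' z z' /\ d z z' < d a z) /\
        (d b z <= d a b ->
          exists z', certified S k' z z' /\ d z z' < d b z)]
  else False.

Lemma certified_leq S k l a b : (k <= l)%N ->
  certified S k a b -> certified S l a b.
Proof.
elim: k l a b => [//|k IH] [//|l] a b kl [Sa Sb ab H]; split => // z Sz za zb.
have [Ha Hb] := H z Sz za zb; split => [/Ha|/Hb] [z' [cz' lt']];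
  by exists z'; split => //; exact: IH cz'.
Qed.

(* [U] is empty for a perfect stable matching, and a single point for one that
   strands this point. *)
Definition stable_matching_off S U m : Prop :=
  [/\ forall a, S a -> ~ U a -> [/\ S (m a), ~ U (m a), m a <> a & m (m a) = a],
      forall a b, S a -> S b -> ~ U a -> ~ U b -> a <> b ->
        ~ (d a b < d a (m a) /\ d a b < d b (m b)) &
      forall u b, S b -> ~ U b -> U u -> d b (m b) <= d b u].

(** If the conclusion failed, one endpoint [c] would have a partner other than [a] and [b] at
    distance at most [d a b]. This partner is a competitor, so the certificate pairs it with a point
    strictly nearer than [c]; by induction that point is [c] itself. *)
Lemma certified_sound S U m : is_subset1 U -> stable_matching_off S U m ->
  forall k a b, certified S k a b -> ~ U a /\ m a = b.
Proof.
move=> U1 [mS mst mU].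
have better c e : S c -> ~ U c -> m c <> e -> d c (m c) <= d c e ->
    (exists z', m (m c) = z' /\ d (m c) z' < d c (m c)) -> False.
  move=> Sc Uc mce le [z' [<-]].
  have [_ _ _ ->] := mS c Sc Uc.
  by rewrite dC ltxx.
elim=> [//|k IH] a b [Sa Sb ab H].
have Ha c : S c -> ~ U c -> c = a \/ c = b ->
    m c <> a -> m c <> b -> d c (m c) <= d a b -> False.
  move=> Sc Uc cab ma mb le.
  have [Smc Umc mcc mmc] := mS c Sc Uc.
  have [H1 H2] := H _ Smc ma mb.
  have : exists z', certified S k (m c) z' /\ d (m c) z' < d c (m c).
    by case: cab => ce; subst c; [exact: H1|exact: H2].
  move=> [z' [/IH [_ mz'] lt]]; apply: (better c (m a)) => //.
  - by move: lt; rewrite -mz' mmc dC ltxx.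
  - by move: lt; rewrite -mz' mmc dC ltxx.
  - by exists z'.
(* If [a] is the stranded point then [b] is matched, as [U] has no second point, and [b] does not
   prefer [a] to its partner. *)
have [Ua|Ua] := pselect (U a).
  have Ub : ~ U b by move=> Ub; apply: ab; exact: U1.
  exfalso; have [_ Umb mbb _] := mS b Sb Ub.
  apply: (Ha b) => //; [by right| |].
    by move=> mba; rewrite mba in Umb.
  by rewrite (dC a b); exact: mU.
split=> //; apply: contrapT => mab.
have [_ Uma maa mma] := mS a Sa Ua.
have [Ub|Ub] := pselect (U b).
  by apply: (Ha a) => //; [left|exact: mU].
have [Smb Umb mbb mmb] := mS b Sb Ub.
have mba : m b <> a by move=> mba; apply: mab; rewrite -mba.
have := mst a b Sa Sb Ua Ub ab.
case: (ltP (d a b) (d a (m a))) => [_|le _]; last by apply: (Ha a) => //; left.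
case: (ltP (d a b) (d b (m b))) => [_ []//|le _].
by apply: (Ha b) => //; right.
Qed.

(** Stability and distinct distances give every competitor a partner strictly nearer than the point
    it competes for, so generations of competitors follow paths of ever shorter edges. These paths
    terminate when there are no descending chains, and local finiteness bounds the number of
    generations uniformly over the competitors of one pair. *)
Lemma certified_complete S m :
  stable_matching_off S set0 m ->
  (forall x y u v, S x -> S y -> S u -> S v ->
     [set x; y] <> [set u; v] -> x <> y -> d x y <> d u v) ->
  (forall a r, finite_set [set z | S z /\ d a z <= r]) ->
  ~ (exists x : nat -> T, (forall i, S (x i)) /\
       forall i, d (x i.+1) (x i.+2) < d (x i) (x i.+1)) ->
  forall a, S a -> exists k, certified S k a (m a).
Proof.
move=> [mS mst _] noneq lfin nochain.
have mSt a : S a -> [/\ S (m a), m a <> a & m (m a) = a].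
  by move=> Sa; have [//|? _ ? ?] := mS a Sa.
pose E := {p : T * T | S p.1 /\ S p.2}.
(* The predecessors of a directed edge are the shorter edges that start at its end, so an infinite
   descent is a descending chain. *)
have wfE : well_founded (fun p q : E =>
    (sval p).1 = (sval q).2 /\
    d (sval p).1 (sval p).2 < d (sval q).1 (sval q).2).
  apply: contrapT => nwf; apply: nochain.
  set rel := (fun p q : E => _) in nwf.
  have [p0 np0] : exists p, ~ Acc rel p by exact/existsNP.
  have step (p : {p | ~ Acc rel p}) :
      exists q : {p | ~ Acc rel p}, rel (sval q) (sval p).
    case: p => p np /=; apply: contrapT => nq; apply: np; split => q rqp.
    by apply: contrapT => nq'; apply: nq; exists (exist _ q nq').
  have /choice[f hf] := step.
  pose g i := sval (iter i f (exist _ p0 np0)).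
  have hg i : rel (g i.+1) (g i) by exact: hf.
  exists (fun i => (sval (g i)).1); split => [i|i].
    by have [] := svalP (g i).
  have [-> _] := hg i.+1; have [e lt] := hg i.
  by rewrite -e in lt.
have blocked c z : S c -> S z -> z <> c -> z <> m c -> d c z <= d c (m c) ->
    d c z < d c (m c) /\ d z (m z) < d c z.
  move=> Sc Sz zc zmc le.
  have [Smc mcc mmc] := mSt c Sc; have [Smz mzz mmz] := mSt z Sz.
  have lt : d c z < d c (m c).
    rewrite lt_neqAle le andbT; apply/eqP; apply: noneq => //; last exact/nesym.
    move=> /seteqP[/(_ z)/= + _].
    by case; [by right|exact: zc|exact: zmc].
  split=> //.
  have [ltz|] := ltP (d c z) (d z (m z)).
    by have [] := mst c z Sc Sz (@id False) (@id False) (nesym zc).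
  rewrite le_eqVlt => /orP[/eqP e|//].
  exfalso; apply: (noneq z (m z) c z) => //; last exact/nesym.
  move=> /seteqP[_ /(_ c)/=]; case; [by left|exact/nesym|].
  by move=> cmz; apply: zmc; rewrite cmz mmz.
have cert_of c : S c ->
    (forall z, S z -> z <> c -> z <> m c ->
       d c z < d c (m c) \/ d (m c) z < d c (m c) ->
       exists k, certified S k z (m z)) ->
    exists k, certified S k c (m c).
  move=> Sc H; have [Smc mcc mmc] := mSt c Sc.
  pose F := [set z | S z /\ d c z <= d c (m c)] `|`
            [set z | S z /\ d (m c) z <= d c (m c)].
  have finF : finite_set F by rewrite finite_setU; split; exact: lfin.
  have /choice[h hk] : forall z, exists k, F z -> z <> c -> z <> m c ->
      (d c z < d c (m c) \/ d (m c) z < d c (m c)) -> certified S k z (m z).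
    move=> z.
    have [[? ? ? ?]|nz] := pselect [/\ S z, z <> c, z <> m c &
        d c z < d c (m c) \/ d (m c) z < d c (m c)].
      have [k hk] : exists k, certified S k z (m z) by exact: H.
      by exists k.
    by exists 0%N => Fz zc zm lt; exfalso; apply: nz; split => //; case: Fz => -[].
  have [K hK] : exists K, forall z, F z -> (h z <= K)%N.
    have /finite_seqP[s sE] := finF.
    exists (\max_(z <- s) h z)%N => z; rewrite sE /= => zs.
    exact: leq_bigmax_seq.
  exists K.+1; split => //; first exact/nesym.
  move=> z Sz zc zmc; split => le.
    have [lt1 lt2] := blocked c z Sc Sz zc zmc le.
    exists (m z); split => //.
    have Fz : F z by left.
    apply: certified_leq (hK z Fz) _; apply: hk => //; by left.
  have le' : d (m c) z <= d (m c) (m (m c)) by rewrite mmc (dC (m c) c).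
  have zmmc : z <> m (m c) by rewrite mmc.
  have [lt1 lt2] := blocked (m c) z Smc Sz zmc zmmc le'.
  exists (m z); split => //.
  have Fz : F z by right.
  apply: certified_leq (hK z Fz) _; apply: hk => //.
  by right; rewrite mmc (dC (m c) c) in lt1.
pose good (p : E) := d (sval p).2 (m (sval p).2) < d (sval p).1 (sval p).2 ->
  exists k, certified S k (sval p).2 (m (sval p).2).
(* Competitors of [m v] are reached from [(u, v)] only through the intermediate edge [(v, m v)]. The
   second conjunct carries the induction across this extra edge. *)
have edge (p : E) : good p /\ forall q : E, (sval q).1 = (sval p).2 ->
    d (sval q).1 (sval q).2 < d (sval p).1 (sval p).2 -> good q.
  elim/(well_founded_ind wfE): p => p IH; split; last first.
    by move=> q e lt; have [] := IH q (conj e lt).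
  case: p IH => -[u v] /= [Su Sv] IH; rewrite /good /= => lt.
  have [Smv mvv mmv] := mSt v Sv.
  apply: cert_of => // z Sz zv zmv [lt1|lt1].
    have [_ lt2] := blocked v z Sv Sz zv zmv (ltW lt1).
    have [] := IH (exist _ (v, z) (conj Sv Sz)); rewrite /good /=.
      by split => //; exact: lt_trans lt.
    by move=> + _; apply.
  have zmmv : z <> m (m v) by rewrite mmv.
  have [_ lt2] : d (m v) z < d (m v) (m (m v)) /\ d z (m z) < d (m v) z.
    by apply: blocked => //; rewrite mmv (dC (m v) v) ltW.
  have [] := IH (exist _ (v, m v) (conj Sv Smv)) => //= _.
  by move=> /(_ (exist _ (m v, z) (conj Smv Sz))); rewrite /good /=; apply.
move=> a Sa; have [Sma maa mma] := mSt a Sa.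
apply: cert_of => // z Sz za zma [lt|lt].
  have [_ lt2] := blocked a z Sa Sz za zma (ltW lt).
  by have [] := edge (exist _ (a, z) (conj Sa Sz)); rewrite /good /= => + _; apply.
have zmma : z <> m (m a) by rewrite mma.
have [_ lt2] : d (m a) z < d (m a) (m (m a)) /\ d z (m z) < d (m a) z.
  by apply: blocked => //; rewrite mma (dC (m a) a) ltW.
by have [] := edge (exist _ (m a, z) (conj Sma Sz)); rewrite /good /= => + _; apply.
Qed.

End certified_pairs.

(** * Euclidean space and rational balls *)

Section enorm_theory.
Context {R : realType} {n : nat}.
Implicit Types (x y a : Rd R n) (e : R).

Lemma coord_le_norm x i : `|x ord0 i| <= `|x|.
Proof.
rewrite [leRHS]/Num.norm /= mx_normrE; apply/bigmax_geP; right => /=.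
by exists (ord0, i).
Qed.

Lemma norm_ltP x e : 0 < e -> (`|x| < e <-> forall i, `|x ord0 i| < e).
Proof.
move=> e0; split=> [xe i|xe]; first exact: le_lt_trans (coord_le_norm x i) xe.
rewrite [ltLHS]/Num.norm /= mx_normrE; apply/bigmax_ltP; split => // -[i j] _ /=.
by rewrite (ord1 i).
Qed.

Lemma norm_le_coord x : x != 0 -> exists i, `|x| = `|x ord0 i|.
Proof.
rewrite -normr_eq0 => /mx_norm_neq0[[i j] /= xij]; exists j.
by rewrite [LHS]xij (ord1 i).
Qed.

Lemma enormN x : enorm (- x) = enorm x.
Proof. by congr Num.sqrt; apply: eq_bigr => i _; rewrite mxE sqrrN. Qed.

Lemma enormC x y : enorm (x - y) = enorm (y - x).
Proof. by rewrite -enormN opprB. Qed.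

Lemma coord_le_enorm x i : `|x ord0 i| <= enorm x.
Proof.
rewrite -sqrtr_sqr ler_wsqrtr// (bigD1 i)//= lerDl sumr_ge0// => j _.
exact: sqr_ge0.
Qed.

Lemma norm_le_enorm x : `|x| <= enorm x.
Proof.
have [->|/norm_le_coord[i ->]] := eqVneq x 0; last exact: coord_le_enorm.
by rewrite normr0 sqrtr_ge0.
Qed.

Lemma enorm_le_norm x : enorm x <= n%:R * `|x|.
Proof.
rewrite -[leRHS]ger0_norm ?mulr_ge0// -sqrtr_sqr ler_wsqrtr//.
rewrite (@le_trans _ _ (\sum_(i < n) `|x| ^+ 2))//.
  apply: ler_sum => i _.
  by rewrite -real_normK ?num_real// lerXn2r ?nnegrE// coord_le_norm.
rewrite sumr_const card_ord -[leLHS]mulr_natl exprMn ler_wpM2r ?sqr_ge0//.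
by rewrite -natrX ler_nat; case: (n) => // k; rewrite -[leqLHS]expn1 leq_pexp2l.
Qed.

Lemma enorm0_eq x : enorm x = 0 -> x = 0.
Proof.
move=> x0; apply/eqP; rewrite -normr_eq0 eq_le normr_ge0 andbT -x0.
exact: norm_le_enorm.
Qed.

Lemma enorm_sub_eq0 x y : enorm (x - y) = 0 <-> x = y.
Proof.
split=> [/enorm0_eq/eqP|->]; first by rewrite subr_eq0 => /eqP.
by rewrite subrr /enorm big1 ?sqrtr0// => i _; rewrite mxE expr0n.
Qed.

Lemma measurable_enorm : measurable_fun setT (@enorm R n).
Proof.
apply: measurableT_comp.
  by apply: nondecreasing_measurable => // x y; exact: ler_wsqrtr.
by apply: measurable_sum => i; apply: measurable_funX; exact: measurable_Rd_coord.
Qed.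

Lemma measurable_Rd_sub d (T : measurableType d) (f g : T -> Rd R n) :
  measurable_fun setT f -> measurable_fun setT g ->
  measurable_fun setT (fun t => f t - g t : Rd R n).
Proof.
move=> mf mg; apply: measurable_fun_Rd => i.
under eq_fun do rewrite !mxE.
by apply: measurable_funB;
  [apply: (measurableT_comp (measurable_Rd_coord i) mf)
  |apply: (measurableT_comp (measurable_Rd_coord i) mg)].
Qed.

Lemma measurable_norm_ball a e : measurable [set x : Rd R n | `|x - a| < e].
Proof.
have [e0|e0] := ltP 0 e; last first.
  rewrite (_ : mkset _ = set0)//; apply/seteqP; split => // x /=.
  by move=> /lt_le_trans /(_ e0); rewrite ltNge normr_ge0.
apply: open_measurable_Rd.
rewrite (_ : mkset _ = ball a e) //; last first.
  by rewrite -ball_normE; apply/seteqP; split => x /=; rewrite distrC.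
exact: ball_open.
Qed.

Lemma compact_norm_ball a e : compact [set x : Rd R n | `|x - a| <= e].
Proof.
apply: bounded_closed_compact.
  exists (`|a| + e); split; first by rewrite num_real.
  move=> M Me x /= xa; rewrite (le_trans _ (ltW Me))//.
  by rewrite -(subrK a x) (le_trans (ler_normD _ _))// addrC lerD.
rewrite (_ : mkset _ = closed_ball_ Num.norm a e).
  exact: closed_closed_ball_.
by apply/seteqP; split => x /=; rewrite distrC.
Qed.

Lemma measurable_set1_Rd a : measurable [set a].
Proof.
rewrite -(setCK [set a]); apply: measurableC; apply: open_measurable_Rd.
exact/closed_openC/accessible_closed_set1/hausdorff_accessible/norm_hausdorff.
Qed.

Lemma ratr_norm_dense a e : 0 < e ->
  exists q : 'rV[rat]_n, `|a - map_mx ratr q| < e.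
Proof.
move=> e0.
have /choice[f hf] i : exists q : rat,
    (ratr q : R) \in `](a ord0 i - e), (a ord0 i + e)[.
  by apply: rat_in_itvoo; rewrite ltrD2l gtrN.
exists (\row_i f i); apply/norm_ltP => // i; rewrite !mxE.
by have := hf i; rewrite in_itv /= -ltr_distl distrC.
Qed.

End enorm_theory.

Section rational_balls.
Context {R : realType} {n : nat}.
Local Notation E := (Rd R n).

(** A countable base of neighbourhoods: quantifiers over the points of a configuration become
    quantifiers over [nat], and finite deletions can be coded by lists of indices. *)
Definition rball (i : nat) : set E :=
  if unpickle i is Some qk then
    let: (q, k) := (qk : 'rV[rat]_n * nat) in
    [set x | `|x - map_mx ratr q| < k.+1%:R^-1]
  else set0.

Lemma measurable_rball i : measurable (rball i).
Proof.
rewrite /rball; case: unpickle => [[q k]|//].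
exact: measurable_norm_ball.
Qed.

Lemma rball_nbhs (a : E) (e : R) : 0 < e ->
  exists i, rball i a /\ rball i `<=` [set x | `|x - a| < e].
Proof.
move=> e0; pose k := Num.truncn (2 / e).
have k0 : (k.+1%:R : R)^-1 < e / 2.
  rewrite -[ltRHS]invrK ltf_pV2 ?posrE// ?invr_gt0 ?divr_gt0//.
  by rewrite invf_div truncnS_gt.
have [q qa] := @ratr_norm_dense R n a k.+1%:R^-1 ltac:(by rewrite invr_gt0).
exists (pickle (q, k)); rewrite /rball pickleK; split => // x /= xq.
rewrite -(subrKA (map_mx ratr q)) (le_lt_trans (ler_normD _ _))//.
rewrite (splitr e) ltrD// ?(lt_trans xq)//.
by rewrite distrC (lt_trans qa).
Qed.

End rational_balls.

(** * Point configurations *)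

Section point_configurations.
Context {R : realType} {n : nat}.
Local Notation E := (Rd R n).
Implicit Types (mu : measures E R) (S A : set E) (x y a : E).

(** [simple_locally_finite] with its witness exposed, so that modified configurations can be
    described by explicit point sets. *)
Definition points_of S mu : Prop :=
  (forall B : set E, compact B -> finite_set (S `&` B)) /\
  (forall A, measurable A -> mu A = \esum_(x in S) \d_x A).

Lemma points_mass S mu A : points_of S mu -> measurable A ->
  mu A = \esum_(x in S `&` A) 1%E.
Proof.
move=> [_ mS] mA; rewrite mS// esum_mkcondr; apply: eq_esum => x _.
by rewrite diracE; case: (x \in A).
Qed.

Lemma points_mass1 S mu A x : points_of S mu -> measurable A ->
  S `&` A = [set x] -> mu A = 1%E.
Proof. by move=> Smu mA SA; rewrite (points_mass Smu)// SA esum_set1. Qed.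

Lemma points_mass0 S mu A : points_of S mu -> measurable A ->
  S `&` A = set0 -> mu A = 0%E.
Proof. by move=> Smu mA SA; rewrite (points_mass Smu)// SA esum_set0. Qed.

Lemma points_mass_ge1 S mu A x : points_of S mu -> measurable A ->
  S x -> A x -> (1 <= mu A)%E.
Proof.
move=> Smu mA Sx Ax; rewrite (points_mass Smu)//.
rewrite -[leLHS](@esum_set1 _ _ x (fun=> 1%E))//.
rewrite esum_mkcond [leRHS]esum_mkcond; apply: le_esum => y _.
case: ifPn => [/set_mem -> |_]; last by case: ifP.
by rewrite ifT// inE.
Qed.

Lemma points_mass_counting S mu A : points_of S mu -> measurable A ->
  mu A = counting (S `&` A).
Proof.
move=> Smu mA; rewrite (points_mass Smu)// /counting.
case: ifPn => /asboolP fA; first by rewrite finite_card_sum.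
rewrite -(infinite_card_dirac R fA); apply: eq_esum => x SAx.
by rewrite diracE mem_set.
Qed.

Lemma mass1_points S mu A : points_of S mu -> measurable A ->
  mu A = 1%E -> exists x, S `&` A = [set x].
Proof.
move=> Smu mA; rewrite (points_mass_counting Smu)// /counting.
case: ifPn => // /asboolP fA [/eqP]; rewrite pnatr_eq1 => /finmap.cardfs1P[x e]; exists x.
by rewrite -(fset_setK fA) e; apply/seteqP; split => y /=; rewrite inE => /eqP.
Qed.

Lemma support_points S mu : points_of S mu -> support mu = S.
Proof.
move=> Smu; apply/seteqP; split => x /=.
  move=> /(mass1_points Smu (measurable_set1_Rd x))[y /seteqP[_ /(_ y)/=]].
  by move=> /(_ erefl)[+ <-].
move=> Sx; apply: (points_mass1 (x := x) Smu); first exact: measurable_set1_Rd.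
by apply/seteqP; split => [y []//|y /= ->].
Qed.

Lemma point_configP mu : point_config mu -> points_of (support mu) mu.
Proof. by move=> [S Smu]; rewrite (support_points Smu). Qed.

Lemma points_of_config S mu : points_of S mu -> point_config mu.
Proof. by move=> Smu; exists S. Qed.

Lemma points_bounded_finite S mu a (r : R) : points_of S mu ->
  finite_set [set z | S z /\ `|z - a| <= r].
Proof. by move=> [/(_ _ (@compact_norm_ball R n a r))]. Qed.

Lemma finite_separated (F : set E) x : finite_set F ->
  exists2 e : R, 0 < e & forall y, F y -> y <> x -> e <= `|y - x|.
Proof.
move=> /finite_seqP[s ->]; elim: s => [|y s [e e0 IH]]; first by exists 1.
have [->|yx] := eqVneq y x.
  by exists e => // z; rewrite /= inE => /orP[/eqP -> //|]; exact: IH.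
exists (Num.min e `|y - x|).
  by rewrite lt_min e0 normr_gt0 subr_eq0.
move=> z; rewrite /= inE => /orP[/eqP -> _|zs zx]; rewrite ge_min ?lexx ?orbT//.
by rewrite IH.
Qed.

Lemma points_separated S mu x : points_of S mu ->
  exists2 e : R, 0 < e & forall y, S y -> y <> x -> e <= `|y - x|.
Proof.
move=> Smu.
have [e e0 He] := finite_separated x (points_bounded_finite x 1 Smu).
exists (Num.min e 1) => [|y Sy yx]; first by rewrite lt_min e0 ltr01.
have [yx1|/ltW yx1] := leP `|y - x| 1; last by rewrite ge_min yx1 orbT.
by rewrite ge_min He.
Qed.

Lemma rball_isolates S mu x : points_of S mu -> S x ->
  exists i, S `&` rball i = [set x].
Proof.
move=> Smu Sx; have [e e0 He] := points_separated x Smu.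
have [i [ix ie]] := rball_nbhs x e0.
exists i; apply/seteqP; split => [y [Sy /ie/= yx]|y /= ->//].
by apply: contrapT => /(He _ Sy); rewrite leNgt yx.
Qed.

Lemma points_translate S mu t : points_of S mu ->
  points_of (shift t @` S) (translate t mu).
Proof.
move=> [fS mS]; split => [B cB|A mA].
  have cB' : compact ((fun x => x - t) @` B).
    apply: (@continuous_compact _ _ (fun x : E => x - t)) => //.
    apply: continuous_subspaceT => x.
    exact: (cvgB cvg_id (cvg_cst _)).
  apply: sub_finite_set (finite_image (shift t) (fS _ cB')) => y [[x Sx <-] Bx].
  exists x => //; split=> //; exists (shift t x) => //=.
  by rewrite /shift addrK.
rewrite [LHS]/= /translate_fun /pushforward mS; last first.
  by rewrite -[X in measurable X]setTI; exact: measurable_shift.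
rewrite esum_image; last by move=> x y _ _ /addIr.
by apply: eq_esum => x _; rewrite !diracE.
Qed.

Lemma points_add_point S mu z : points_of S mu -> ~ S z ->
  points_of (z |` S) (add_point mu z).
Proof.
move=> [fS mS] Sz; split => [B cB|A mA].
  rewrite setIUl finite_setU; split; last exact: fS.
  exact: sub_finite_set (@subIsetl _ _ _) _.
rewrite /add_point /= /measure_add /= /msum !big_ord_recl big_ord0 adde0 /=.
rewrite (esumID [set z])//.
have -> : (z |` S) `&` [set z] = [set z].
  by apply/seteqP; split => [y []//|y /= ->]; split => //; left.
have -> : (z |` S) `&` ~` [set z] = S.
  apply/seteqP; split => [y [[//|//]]|y Sy]; split; first by right.
  by move=> /= yz; rewrite yz in Sy.
by rewrite esum_set1; [rewrite mS// addeC|exact: measure_ge0].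
Qed.

Lemma points_mrestr S mu A (mA : measurable A) : points_of S mu ->
  points_of (S `&` A) (mrestr mu mA).
Proof.
move=> [fS mS]; split => [B cB|B mB].
  by apply: sub_finite_set (fS _ cB) => x [[]].
rewrite [LHS]/= /mrestr mS; last exact: measurableI.
rewrite esum_mkcondr; apply: eq_esum => x _.
by rewrite !diracE in_setI; case: (x \in A); rewrite (andbT, andbF).
Qed.

End point_configurations.

(** * Measurability of the certified matching *)

Section measurable_comprehension.
Context d (T : measurableType d).
Implicit Types P Q : T -> Prop.

Lemma measurable_comp_and P Q : measurable [set x | P x] ->
  measurable [set x | Q x] -> measurable [set x | P x /\ Q x].
Proof. exact: measurableI. Qed.

Lemma measurable_comp_not P : measurable [set x | P x] ->
  measurable [set x | ~ P x].
Proof. exact: measurableC. Qed.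

Lemma measurable_comp_imply P Q : measurable [set x | P x] ->
  measurable [set x | Q x] -> measurable [set x | P x -> Q x].
Proof.
move=> mP mQ; rewrite (_ : mkset _ = ~` [set x | P x] `|` [set x | Q x]).
  by apply: measurableU => //; exact: measurableC.
apply/seteqP; split => x /= => [PQ|[nP Px|Qx Px]//].
by have [Px|nPx] := pselect (P x); [right; exact: PQ|left].
Qed.

Lemma measurable_comp_forall (P : nat -> T -> Prop) :
  (forall i, measurable [set x | P i x]) -> measurable [set x | forall i, P i x].
Proof.
move=> mP; rewrite (_ : mkset _ = \bigcap_i [set x | P i x]).
  exact: bigcapT_measurable.
by apply/seteqP; split => x /=; [move=> H i _|move=> H i; exact: H].
Qed.

Lemma measurable_comp_exists (P : nat -> T -> Prop) :
  (forall i, measurable [set x | P i x]) -> measurable [set x | exists i, P i x].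
Proof.
move=> mP; rewrite (_ : mkset _ = \bigcup_i [set x | P i x]).
  exact: bigcupT_measurable.
by apply/seteqP; split => x /= => [[i ?]|[i _ ?]]; exists i.
Qed.

Lemma measurable_comp_cst (Q : Prop) : measurable [set _ : T | Q].
Proof.
have [q|q] := pselect Q.
  by rewrite (_ : mkset _ = setT)//; apply/seteqP; split.
by rewrite (_ : mkset _ = set0)//; apply/seteqP; split.
Qed.

End measurable_comprehension.

Section located_points.
Context {R : realType} {n : nat}.
Local Notation E := (Rd R n).
Local Notation edist := (fun x y : E => enorm (x - y)).
Implicit Types (mu : measures E R) (S A : set E).

Lemma measurable_eval A : measurable A ->
  measurable_fun setT (fun mu : measures E R => mu A).
Proof.
move=> mA _ B mB; apply: sub_sigma_algebra.
by exists A => //; exists B.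
Qed.

Lemma measurable_fun_measures d (T : measurableType d)
    (f : T -> measures E R) :
  (forall A, measurable A -> measurable_fun setT (fun t => f t A)) ->
  measurable_fun setT f.
Proof.
move=> mf; pose G := \bigcup_(A in @measurable _ E)
  preimage_set_system setT (fun mu : measures E R => mu A) measurable.
apply: (@measurability _ _ _ _ _ _ G) => //.
move=> _ [_ [A mA [B mB <-]] <-].
rewrite !setTI -comp_preimage -[X in measurable X]setTI.
exact: mf.
Qed.

Definition occupied (i : nat) mu : Prop := mu (rball i) = 1%E.

(** If the ball contains exactly one point of a configuration, the measure is a Dirac mass there and
    the integrals are the coordinates of that point. Written as an integral, this choice of a point
    is measurable in [mu]. *)
Definition loc (i : nat) mu : E :=
  \row_j fine (\int[mu]_(y in rball i) (y ord0 j)%:E).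

Lemma measurable_occupied i : measurable [set mu | occupied i mu].
Proof.
rewrite (_ : mkset _ = (fun mu : measures E R => mu (rball i)) @^-1` [set 1%E])//.
rewrite -[X in measurable X]setTI.
exact: (measurable_eval (@measurable_rball R n i)).
Qed.

Lemma measurable_integral_measures (f : E -> \bar R) :
  measurable_fun setT f ->
  measurable_fun setT (fun mu : measures E R => \int[mu]_y f y)%E.
Proof.
move=> mf; under eq_fun do rewrite integralE.
apply: emeasurable_funB.
  by apply: (@measurable_fun_integral_kernel _ _ _ _ _
    (fun mu : measures E R => mu)) => //;
    [exact: measurable_eval|exact: measurable_funepos].
by apply: (@measurable_fun_integral_kernel _ _ _ _ _
    (fun mu : measures E R => mu)) => //;
    [exact: measurable_eval|exact: measurable_funeneg].
Qed.

Lemma measurable_loc i : measurable_fun setT (loc i).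
Proof.
apply: measurable_fun_Rd => j; under eq_fun do rewrite mxE integral_mkcond.
apply: measurableT_comp => //; apply: measurable_integral_measures.
apply/(measurable_restrictT _ (measurable_rball i)).
apply: measurable_funTS.
exact: (measurableT_comp (@EFin_measurable R setT) (measurable_Rd_coord j)).
Qed.

Lemma loc_points S mu i x : points_of S mu -> S `&` rball i = [set x] ->
  loc i mu = x.
Proof.
move=> Smu Sx; have mi := @measurable_rball R n i.
have ix : rball i x by have /seteqP[_ /(_ x erefl)[]] := Sx.
apply/rowP => j; rewrite mxE.
rewrite (eq_measure_integral \d_x).
  rewrite integral_dirac//.
    by rewrite diracE mem_set// mul1e.
  apply: measurable_funTS.
  exact: (measurableT_comp (@EFin_measurable R setT) (measurable_Rd_coord j)).
move=> A mA Ai; rewrite [LHS](points_mass Smu mA) /=.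
have [Ax|nAx] := pselect (A x).
  rewrite diracE mem_set// -[RHS](@esum_set1 _ _ x (fun=> 1%E))//.
  congr esum; rewrite -Sx; apply/seteqP; split => y [Sy Ay]; split => //.
    exact: Ai.
  by have /seteqP[/(_ y (conj Sy Ay)) -> _] := Sx.
rewrite diracE memNset//= -[RHS](@esum_set0 _ E (fun=> 1%E)); congr esum.
apply/seteqP; split => // y [Sy Ay].
by apply: nAx; have /seteqP[/(_ y (conj Sy (Ai _ Ay))) <- _] := Sx.
Qed.

Lemma occupied_points S mu i : points_of S mu -> occupied i mu ->
  S `&` rball i = [set loc i mu].
Proof.
move=> Smu /(mass1_points Smu (@measurable_rball R n i))[x Sx].
by rewrite (loc_points Smu Sx).
Qed.

Lemma points_occupied S mu x : points_of S mu -> S x ->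
  exists i, [/\ occupied i mu, loc i mu = x & S `&` rball i = [set x]].
Proof.
move=> Smu Sx; have [i Si] := rball_isolates Smu Sx.
exists i; split => //; last exact: loc_points Si.
exact: (points_mass1 Smu (@measurable_rball R n i) Si).
Qed.

(** The support in terms of countably many measurable functions of [mu]. The two agree on
    configurations, by [atoms_points]. *)
Definition atoms mu : set E := [set loc i mu | i in [set i | occupied i mu]].

Lemma atoms_points S mu : points_of S mu -> atoms mu = S.
Proof.
move=> Smu; apply/seteqP; split => [_ [i oi <-]|x Sx].
  by have /seteqP[_ /(_ _ erefl)[]] := occupied_points Smu oi.
by have [i [oi <- _]] := points_occupied Smu Sx; exists i.
Qed.

Lemma measurable_mem_atoms (f : measures E R -> E) : measurable_fun setT f ->
  measurable [set mu | atoms mu (f mu)].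
Proof.
move=> mf.
rewrite (_ : mkset _ = [set mu | exists i, occupied i mu /\
    enorm (loc i mu - f mu) = 0]); last first.
  apply/seteqP; split => mu /=.
    by move=> [i oi e]; exists i; split => //; apply/enorm_sub_eq0.
  by move=> [i [oi /enorm_sub_eq0 e]]; exists i.
apply: measurable_comp_exists => i; apply: measurable_comp_and.
  exact: measurable_occupied.
have := measurableT_comp measurable_enorm (measurable_Rd_sub (measurable_loc i) mf).
by move=> /(_ measurableT [set 0] (measurable_set1 _)); rewrite setTI.
Qed.

Lemma measurable_dist_le (f g h k : measures E R -> E) :
  measurable_fun setT f -> measurable_fun setT g ->
  measurable_fun setT h -> measurable_fun setT k ->
  measurable [set mu | enorm (f mu - g mu) <= enorm (h mu - k mu)].
Proof.
move=> mf mg mh mk.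
have := @measurable_fun_ler _ _ R setT (fun mu => enorm (f mu - g mu))
  (fun mu => enorm (h mu - k mu)).
move=> /(_ (measurableT_comp measurable_enorm (measurable_Rd_sub mf mg))).
move=> /(_ (measurableT_comp measurable_enorm (measurable_Rd_sub mh mk))).
by move=> /(_ measurableT [set true] ltac:(by [])); rewrite setTI.
Qed.

Lemma measurable_dist_lt (f g h k : measures E R -> E) :
  measurable_fun setT f -> measurable_fun setT g ->
  measurable_fun setT h -> measurable_fun setT k ->
  measurable [set mu | enorm (f mu - g mu) < enorm (h mu - k mu)].
Proof.
move=> mf mg mh mk.
rewrite (_ : mkset _ = ~` [set mu | enorm (h mu - k mu) <= enorm (f mu - g mu)]).
  by apply: measurableC; exact: measurable_dist_le.
by apply/seteqP; split => mu /=; rewrite ltNge => /negP.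
Qed.

Lemma measurable_neq (f g : measures E R -> E) :
  measurable_fun setT f -> measurable_fun setT g ->
  measurable [set mu | f mu <> g mu].
Proof.
move=> mf mg.
rewrite (_ : mkset _ = ~` [set mu | enorm (f mu - g mu) <= enorm (f mu - f mu)]).
  by apply: measurableC; exact: measurable_dist_le.
have -> : (fun mu => f mu <> g mu) = ~` (fun mu => f mu = g mu) by [].
congr (~` _); apply/seteqP; split => mu /=.
  by move=> ->.
have -> : enorm (f mu - f mu) = 0 by apply/enorm_sub_eq0.
by move=> le; apply/enorm_sub_eq0/eqP; rewrite eq_le le sqrtr_ge0.
Qed.

(** Competitors and their certified partners are all of the form [loc i mu], so both quantifiers
    over points are countable. Arbitrary measurable [f] and [g] let the induction pass to these
    points. *)
Lemma measurable_certified k (f g : measures E R -> E) :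
  measurable_fun setT f -> measurable_fun setT g ->
  measurable [set mu | certified edist (atoms mu) k (f mu) (g mu)].
Proof.
elim: k f g => [|k IH] f g mf mg /=.
  by rewrite (_ : mkset _ = set0)//.
rewrite (_ : mkset _ = [set mu | (atoms mu (f mu) /\ atoms mu (g mu)) /\
    (f mu <> g mu /\ forall i, occupied i mu ->
      loc i mu <> f mu -> loc i mu <> g mu ->
    ((enorm (f mu - loc i mu) <= enorm (f mu - g mu) ->
      exists j, occupied j mu /\
        certified edist (atoms mu) k (loc i mu) (loc j mu) /\
        enorm (loc i mu - loc j mu) < enorm (f mu - loc i mu)) /\
    (enorm (g mu - loc i mu) <= enorm (f mu - g mu) ->
      exists j, occupied j mu /\
        certified edist (atoms mu) k (loc i mu) (loc j mu) /\
        enorm (loc i mu - loc j mu) < enorm (g mu - loc i mu))))]); last first.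
  have cert_atom mu a b : certified edist (atoms mu) k a b -> atoms mu b.
    by case: (k) => [//|?] [].
  apply/seteqP; split => mu /=.
    move=> [Sf Sg fg H]; split => //; split => // i oi zf zg.
    have Si : atoms mu (loc i mu) by exists i.
    have [Hf Hg] := H _ Si zf zg.
    split=> [/Hf|/Hg] [z [cz lt]]; have [j oj ej] := cert_atom _ _ _ cz;
      by exists j; rewrite ej.
  move=> [[Sf Sg] [fg H]]; split => // z [i oi <-] zf zg.
  have [Hf Hg] := H _ oi zf zg.
  by split=> [/Hf|/Hg] [j [oj [cz lt]]]; exists (loc j mu).
have ml := measurable_loc.
apply: measurable_comp_and.
  by apply: measurable_comp_and; exact: measurable_mem_atoms.
apply: measurable_comp_and; first exact: measurable_neq.
apply: measurable_comp_forall => i.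
apply: measurable_comp_imply; first exact: measurable_occupied.
apply: measurable_comp_imply; first exact: measurable_neq.
apply: measurable_comp_imply; first exact: measurable_neq.
have cert_lt (h : measures E R -> E) : measurable_fun setT h -> measurable [set mu | exists j,
    occupied j mu /\ certified edist (atoms mu) k (loc i mu) (loc j mu) /\
    enorm (loc i mu - loc j mu) < enorm (h mu - loc i mu)].
  move=> mh; apply: measurable_comp_exists => j; apply: measurable_comp_and.
    exact: measurable_occupied.
  by apply: measurable_comp_and; [exact: IH|exact: measurable_dist_lt].
by apply: measurable_comp_and; apply: measurable_comp_imply;
  [exact: measurable_dist_le|exact: cert_lt
  |exact: measurable_dist_le|exact: cert_lt].
Qed.

Definition unmatched : set (measures E R) :=
  [set mu | exists i, occupied i mu /\ forall j k,
     ~ certified edist (atoms mu) k (loc i mu) (loc j mu)].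

Lemma measurable_unmatched : measurable unmatched.
Proof.
apply: measurable_comp_exists => i; apply: measurable_comp_and.
  exact: measurable_occupied.
apply: measurable_comp_forall => j; apply: measurable_comp_forall => k.
by apply: measurable_comp_not; apply: measurable_certified; exact: measurable_loc.
Qed.

Lemma unmatchedP S mu : points_of S mu -> unmatched mu <->
  exists2 x, S x & forall y k, ~ certified edist S k x y.
Proof.
move=> Smu; rewrite /unmatched /= (atoms_points Smu); split.
  move=> [i [oi H]]; exists (loc i mu).
    by have /seteqP[_ /(_ _ erefl)[]] := occupied_points Smu oi.
  move=> y [//|k] /[dup] c [_ Sy _ _].
  by have [j [_ e _]] := points_occupied Smu Sy; apply: (H j k.+1); rewrite e.
move=> [x Sx H]; have [i [oi e _]] := points_occupied Smu Sx.
by exists i; split => // j k; rewrite e; exact: H.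
Qed.

Lemma measurable_half_open_cube : measurable (@half_open_cube R n).
Proof.
rewrite (_ : half_open_cube (n := n) = \bigcap_(i in [set: 'I_n])
    ((fun x : E => x ord0 i : R) @^-1` `[0, 1[%classic)).
  apply: fin_bigcap_measurable => // i _.
  by rewrite -[X in measurable X]setTI; exact: measurable_Rd_coord.
apply/seteqP; split => x /= H i; last by have := H i I; rewrite /= in_itv.
by move=> _; rewrite /= in_itv; exact: H.
Qed.

(** The absence of a short certificate replaces the matching distance, which makes this an event of
    the configuration. Where the matching is the expected one, it says that some point of the cube
    has matching distance above [r]; see [far_matched_matching_distance]. *)
Definition far_matched (r : R) : set (measures E R) :=
  [set mu | exists i, occupied i mu /\ half_open_cube (loc i mu) /\
    forall j k, ~ (certified edist (atoms mu) k (loc i mu) (loc j mu) /\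
                   enorm (loc i mu - loc j mu) <= r)].

Lemma measurable_far_matched r : measurable (far_matched r).
Proof.
apply: measurable_comp_exists => i; apply: measurable_comp_and.
  exact: measurable_occupied.
apply: measurable_comp_and.
  have := measurable_loc i measurableT measurable_half_open_cube.
  by rewrite setTI.
apply: measurable_comp_forall => j; apply: measurable_comp_forall => k.
apply: measurable_comp_not; apply: measurable_comp_and.
  by apply: measurable_certified; exact: measurable_loc.
have := @measurable_fun_ler _ _ R setT (fun mu => enorm (loc i mu - loc j mu))
  (fun=> r).
move=> /(_ (measurableT_comp measurable_enorm
  (measurable_Rd_sub (measurable_loc i) (measurable_loc j)))).
by move=> /(_ ltac:(by []) measurableT [set true] ltac:(by [])); rewrite setTI.
Qed.

Lemma far_matchedP S mu r : points_of S mu -> far_matched r mu <->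
  exists2 x, S x /\ half_open_cube x &
    forall y k, ~ (certified edist S k x y /\ enorm (x - y) <= r).
Proof.
move=> Smu; rewrite /far_matched /= (atoms_points Smu); split.
  move=> [i [oi [Qi H]]]; exists (loc i mu).
    by split => //; have /seteqP[_ /(_ _ erefl)[]] := occupied_points Smu oi.
  move=> y [[]//|k] [/[dup] c [_ Sy _ _] le].
  by have [j [_ e _]] := points_occupied Smu Sy; apply: (H j k.+1); rewrite e.
move=> [x [Sx Qx] H]; have [i [oi e _]] := points_occupied Smu Sx.
by exists i; split => //; split => [|j k]; rewrite e //; exact: H.
Qed.

End located_points.

(** * Null sets and lower integrals *)

Section almost_everywhere.
Context d (T : measurableType d) (R : realType) (mu : {measure set T -> \bar R}).
Local Open Scope ereal_scope.

Lemma ae_not_measure0 (A : set T) : measurable A ->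
  {ae mu, forall x, ~ A x} -> mu A = 0.
Proof.
move=> mA [N [mN N0 sub]]; apply: (subset_measure0 mA mN _ N0).
by move=> x Ax; apply: sub => /= /(_ Ax).
Qed.

Lemma measure0_ae_not (A : set T) : measurable A -> mu A = 0 ->
  {ae mu, forall x, ~ A x}.
Proof. by move=> mA A0; exists A; split => // x /= /contrapT. Qed.

(* No measurability is required of the smaller function, which is then
   integrated as a lower integral. *)
Lemma ae_ge0_le_lower_integral (f g : T -> \bar R) :
  (forall x, 0 <= f x) -> (forall x, 0 <= g x) -> measurable_fun setT g ->
  {ae mu, forall x, f x <= g x} -> \int[mu]_x f x <= \int[mu]_x g x.
Proof.
move=> f0 g0 mg [N [mN N0 sub]].
(* Infinite on the exceptional null set, so [h] dominates [f] everywhere and still has the integral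
   of [g]. *)
pose h x := g x + +oo * (\1_N x)%:E.
have mh : measurable_fun setT h.
  by apply: emeasurable_funD => //; apply: measurable_funeM; exact/measurable_EFinP.
have h0 x : 0 <= h x by rewrite adde_ge0// mule_ge0// lee_fin.
have -> : \int[mu]_x g x = \int[mu]_x h x.
  apply: ge0_ae_eq_integral => //; exists N; split => // x /= H.
  by apply: contrapT => Nx; apply: H => _; rewrite /h indicE memNset// mule0 adde0.
rewrite !ge0_integralTE//; apply: ereal_sup_le => _ [s sf <-].
exists s => // x; apply: le_trans (sf x) _.
rewrite /h indicE; case: (boolP (x \in N)) => [_|/negP Nx].
  by rewrite mule1 addey ?leey// gt_eqF// (lt_le_trans _ (g0 x)).
rewrite mule0 adde0.
by apply: contrapT => H; apply: Nx; apply/mem_set/sub.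
Qed.

End almost_everywhere.

(** * Stable matchings and their certificates *)

Section matched_configurations.
Context {R : realType} {n : nat}.
Local Notation E := (Rd R n).
Local Notation edist := (fun x y : E => enorm (x - y)).

Lemma upair_ofC (x y : E) : upair_of x y = upair_of y x.
Proof. by apply: eq_exist => /=; rewrite setUC. Qed.

Lemma set2_other (x y a b : E) : [set x; y] = [set a; b] -> a <> b ->
  x = a -> y = b.
Proof.
move=> /seteqP[_ /(_ b)/=] /(_ (or_intror erefl)) + ab xa.
by case=> // bx; exfalso; apply: ab; rewrite bx.
Qed.

Lemma matching_off (mu : measures E R) (m : measures (upair R n) R) :
  perfect_matching mu m -> stable_matching mu m ->
  stable_matching_off edist (support mu) set0 (partner m).
Proof.
move=> [medge muniq] mst.
have partnerP x : support mu x -> support m (upair_of x (partner m x)).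
  move=> Sx; have [e [[me ex] _]] := muniq x Sx.
  have [a [b [_ _ _ eab]]] := medge e me.
  rewrite /partner; case: xgetP => [y _ //|/= no].
  move: ex; rewrite eab /= => -[xa|xb]; exfalso.
    by apply: (no b); rewrite /= xa -eab.
  by apply: (no a); rewrite /= xb upair_ofC -eab.
have partner_mem x : support mu x ->
    support mu (partner m x) /\ partner m x <> x.
  move=> /partnerP /medge[a [b [Sa Sb ab]]] /(congr1 sval) /= e.
  have [xa|xb] : x = a \/ x = b by have /seteqP[/(_ x (or_introl erefl))] := e.
    by rewrite (set2_other e ab xa) xa; split => //; exact/nesym.
  rewrite (setUC [set a]) in e.
  by rewrite (set2_other e (nesym ab) xb) xb.
split=> //.
- move=> a Sa _; have [Sp pa] := partner_mem a Sa.
  split => //.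
  have [e [_ eu]] := muniq _ Sp.
  have h1 := eu (upair_of a (partner m a)) (conj (partnerP a Sa) (or_intror erefl)).
  have h2 := eu (upair_of _ _) (conj (partnerP _ Sp) (or_introl erefl)).
  have := congr1 sval (esym h1); rewrite h2 /= (setUC [set a]) => e12.
  exact: set2_other (esym e12) _ erefl.
- move=> a b Sa Sb _ _ ab [lt1 lt2]; apply: mst; exists a, b; split => //.
  by rewrite lt_min; apply/andP.
Qed.

Lemma matched_certified (mu : measures E R) (m : measures (upair R n) R) :
  point_config mu -> non_equidistant mu -> ~ has_descending_chain mu ->
  perfect_matching mu m -> stable_matching mu m ->
  forall a, support mu a -> exists k, certified edist (support mu) k a (partner m a).
Proof.
move=> /point_configP Smu noneq nochain pm sm.
apply: certified_complete => //; first exact: enormC.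
  exact: matching_off.
move=> a r; apply: sub_finite_set (points_bounded_finite a r Smu) => z [Sz az].
by split => //=; rewrite (le_trans (norm_le_enorm _))// enormC.
Qed.

End matched_configurations.

Section good_event.
Context {R : realType} {n : nat} {dO : measure_display}.
Context {Omega : measurableType dO} (P : probability Omega R).
Context (X : Omega -> measures (Rd R n) R) (M : Omega -> measures (upair R n) R).
Local Notation E := (Rd R n).
Local Notation edist := (fun x y : E => enorm (x - y)).

(** All that later steps assume about the matching at the outcome [w]; it holds almost surely by
    [ae_matched_at]. *)
Definition matched_at (w : Omega) : Prop :=
  stable_matching_off edist (support (X w)) set0 (partner (M w)) /\
  forall a, support (X w) a ->
    exists k, certified edist (support (X w)) k a (partner (M w) a).

Lemma ae_matched_at : Rd_point_process X ->
  {ae P, forall w, non_equidistant (X w)} ->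
  {ae P, forall w, ~ has_descending_chain (X w)} ->
  stable_matching_scheme P X M -> {ae P, forall w, matched_at w}.
Proof.
move=> [_ cX] noneq nochain [[_ pm] sm].
apply: filterS (filterI (filterI noneq nochain) (filterI pm sm)).
move=> w [[h1 h2] [h3 h4]]; split; first exact: matching_off.
exact: (matched_certified (cX w) h1 h2 h3 h4).
Qed.

Lemma matched_at_not_unmatched w : point_config (X w) -> matched_at w ->
  ~ unmatched (X w).
Proof.
move=> /point_configP SX [_ cert] /(unmatchedP SX)[x Sx nx].
by have [k] := cert x Sx; exact: nx.
Qed.

Lemma unmatched_null : Rd_point_process X -> {ae P, forall w, matched_at w} ->
  P (X @^-1` unmatched) = 0%E.
Proof.
move=> [mX cX] good; apply: ae_not_measure0.
  by have := mX measurableT _ (@measurable_unmatched R n); rewrite setTI.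
by apply: filterS good => w gw; exact: matched_at_not_unmatched (cX w) gw.
Qed.

Lemma far_matched_matching_distance w r : point_config (X w) -> matched_at w ->
  far_matched r (X w) <-> exists2 x, support (X w) x /\ half_open_cube x &
    r < matching_distance (M w) x.
Proof.
move=> /point_configP SX [off cert]; split.
  move=> /(far_matchedP _ SX)[x SQx nx]; exists x => //.
  rewrite ltNge; apply/negP => le; have [k] := cert x SQx.1.
  by move=> ck; exact: (nx _ k (conj ck le)).
move=> [x SQx lt]; apply/(far_matchedP _ SX); exists x => // y k [c le].
have [_ xy] := certified_sound (@enormC R n) (fun _ _ => False_ind _) off c.
by move: lt; rewrite /matching_distance xy ltNge le.
Qed.

End good_event.

(** * Summability over the lattice *)

Section lattice_count.
Context {R : realType} {n : nat}.
Implicit Types (k : 'rV[int]_n) (t : R).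

Definition intv k : Rd R n := map_mx intr k.

Lemma absz_le_natr (z : int) (m : nat) : `|z%:~R : R| <= m%:R -> (`|z| <= m)%N.
Proof. by rewrite -intr_norm -abszE -pmulrn ler_nat. Qed.

Lemma absz_shift (z : int) (m : nat) : (`|z| <= m)%N ->
  (absz (z + m%:Z)%R < m.*2.+1)%N.
Proof. lia. Qed.

Lemma absz_shift_inj (y z : int) (m : nat) : (`|y| <= m)%N -> (`|z| <= m)%N ->
  absz (y + m%:Z)%R = absz (z + m%:Z)%R -> y = z.
Proof. lia. Qed.

(** Coordinates between [-m] and [m], shifted by [m], give an injection into the functions from
    ['I_n] to ['I_(m.*2.+1)]. *)
Lemma card_lattice_ball (g : nat -> option 'rV[int]_n) (m J : nat) :
  (forall i j k, g i = Some k -> g j = Some k -> i = j) ->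
  (#|[pred j : 'I_J | if g j is Some k then (`|intv k| <= m%:R)%R else false]|
     <= m.*2.+1 ^ n)%N.
Proof.
move=> ginj; set c := [pred j | _].
pose h (j : 'I_J) : {ffun 'I_n -> 'I_(m.*2.+1)} :=
  [ffun i => inord (absz ((odflt 0 (g j) : 'rV[int]_n) ord0 i + m%:Z))].
rewrite -[X in (_ <= X ^ _)%N]card_ord -[X in (_ <= _ ^ X)%N]card_ord -card_ffun.
have hinj : {in c &, injective h}.
  move=> i j; rewrite !inE.
  case ei : (g i) => [k|//]; case ej : (g j) => [l|//] ck cl hij.
  suff kl : k = l by apply: ord_inj; apply: (ginj i j k); rewrite ?ei// ej kl.
  apply/rowP => a.
  have bnd (z : int) : `|z%:~R : R| <= m%:R -> (absz (z + m%:Z)%R < m.*2.+1)%N.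
    by move=> /absz_le_natr; exact: absz_shift.
  have co (v : 'rV[int]_n) : `|intv v| <= m%:R -> `|(v ord0 a)%:~R : R| <= m%:R.
    by apply: le_trans; have := coord_le_norm (intv v) a; rewrite mxE.
  move/ffunP/(_ a)/(congr1 val): hij; rewrite !ffunE ei ej /=.
  rewrite (inordK (bnd _ (co _ ck))) (inordK (bnd _ (co _ cl))) => e.
  exact: absz_shift_inj (absz_le_natr (co _ ck)) (absz_le_natr (co _ cl)) e.
rewrite -(card_in_imset hinj); exact: max_card.
Qed.

(** Taken at [t = D w] and integrated, this turns a finite moment of order [n] into summability of
    the tail probabilities over the lattice. *)
Lemma lattice_sum_le (g : nat -> option 'rV[int]_n) t :
  (forall i j k, g i = Some k -> g j = Some k -> i = j) ->
  (\sum_(0 <= j <oo) (if g j is Some k then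
      ((Num.max 0 (`|intv k| - 1) < t)%R%:R)%:E else 0)
    <= (7 ^+ n * (1 + Num.max 0 t ^+ n))%:E)%E.
Proof.
move=> ginj; set u := Num.max 0 t.
have u0 : 0 <= u by rewrite le_max lexx.
apply: lime_le.
  by apply: is_cvg_nneseries => j _; case: (g j) => // k; rewrite lee_fin.
apply: nearW => J.
(* A lattice point that is counted has norm below [u + 1 <= m], and
   [2 m + 1 <= 2 u + 5 <= 7 max(1, u)], whence the constant 7. *)
pose m := (Num.truncn u).+2.
have mu : u + 1 <= m%:R by rewrite -natr1 lerD2r ltW// truncnS_gt.
apply: (@le_trans _ _ ((m.*2.+1 ^ n)%N%:R)%:E); last first.
  rewrite lee_fin natrX.
  have um : m.*2.+1%:R <= 7 * Num.max 1 u.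
    have : (Num.truncn u)%:R <= u by rewrite truncn_le.
    rewrite /m -natr1 -mul2n natrM -!natr1.
    by case: (leP 1 u) => ?; lra.
  apply: (@le_trans _ _ ((7 * Num.max 1 u) ^+ n)).
    by rewrite lerXn2r ?nnegrE// mulr_ge0// le_max ler01.
  rewrite exprMn ler_wpM2l ?exprn_ge0//.
  by case: (leP 1 u) => ?; rewrite ?expr1n ?lerDr ?lerDl// exprn_ge0.
rewrite big_mkord.
have := @card_lattice_ball g m J ginj; rewrite -(@ler_nat R) -lee_fin.
apply: le_trans; rewrite -sum1_card natr_sum -sumEFin [leRHS]big_mkcond.
apply: lee_sum => j _; rewrite inE.
case: (g j) => [k|//].
case: (ltP (Num.max 0 (`|intv k| - 1)) t) => [lt|_].
2: by case: ifP => _; rewrite ?lee_fin.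
rewrite ifT// (le_trans _ mu)// -lerBlDr.
have : `|intv k| - 1 <= Num.max 0 (`|intv k| - 1) by rewrite le_max lexx orbT.
move=> /le_trans; apply; rewrite (le_trans (ltW lt))//.
by rewrite /u le_max lexx orbT.
Qed.

End lattice_count.

Section certified_translation.
Context {R : realType} {n : nat}.
Local Notation E := (Rd R n).
Local Notation edist := (fun x y : E => enorm (x - y)).

(** Stands in for equivariance of [M]: a certificate in a translated configuration is carried back
    to [X w], where the matching is known. *)
Lemma certified_shift (S : set E) (t a b : E) k :
  certified edist (shift t @` S) k (a + t) (b + t) -> certified edist S k a b.
Proof.
have mem c : (shift t @` S) (c + t) -> S c by move=> [d Sd /addIr <-].
have subt c d : c + t - (d + t) = c - d :> E by rewrite opprD addrACA subrr addr0.
elim: k a b => [//|k IH] a b [/mem Sa /mem Sb ab H].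
split => // [abE|z Sz za zb]; first by apply: ab; rewrite abE.
have [||Ha Hb] := H (z + t) (ex_intro2 _ _ z Sz erefl).
- by move=> /addIr.
- by move=> /addIr.
move: Ha Hb; rewrite !subt => Ha Hb.
split=> [/Ha|/Hb] [z' [c lt]]; exists (z' - t);
  rewrite -{}[z'](subrK t) subt in c lt;
  by split => //; exact: IH.
Qed.

End certified_translation.

(** * Tail bound for points matched far away *)

Section competitors.
Context {R : realType} {n : nat} {dO : measure_display}.
Context {Omega : measurableType dO} (P : probability Omega R).
Context (X : Omega -> measures (Rd R n) R) (M : Omega -> measures (upair R n) R).
Local Notation E := (Rd R n).
Local Notation Q := (@half_open_cube R n).
Hypothesis X_pp : Rd_point_process X.
Hypothesis X_good : {ae P, forall w, matched_at X M w}.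

Let SX w : points_of (support (X w)) (X w).
Proof. exact: point_configP (X_pp.2 w). Qed.

Lemma measurable_eval_process A : measurable A ->
  measurable_fun setT (fun w => X w A).
Proof. by move=> mA; exact: measurableT_comp (measurable_eval mA) X_pp.1. Qed.

Lemma measurable_process_event (A : set (measures E R)) : measurable A ->
  measurable (X @^-1` A).
Proof. by move=> mA; have := X_pp.1 measurableT A mA; rewrite setTI. Qed.

Lemma cube_finite S (mu : measures E R) : points_of S mu -> finite_set (S `&` Q).
Proof.
move=> Smu; apply: sub_finite_set (points_bounded_finite 0 1 Smu) => x [Sx Qx].
split => //=; rewrite subr0 leNgt; apply/negP => x1.
have /norm_le_coord[i xi] : x != 0 by rewrite -normr_gt0 (lt_trans ltr01 x1).
have /andP[x0 xlt] := Qx i.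
by move: x1; rewrite xi ger0_norm// ltNge ltW.
Qed.

(** The integrand of [typical_distance_cdf]. Its measurability in [w] is not established, so its
    integral is treated as a lower integral. *)
Definition lower_count (r : R) (w : Omega) : \bar R :=
  counting [set x : E | [/\ support (X w) x, Q x &
                            matching_distance (M w) x <= r]].

Lemma lower_count_le r w : matched_at X M w ->
  (lower_count r w <= X w Q - (\1_(X @^-1` far_matched r) w)%:E)%E.
Proof.
move=> gw; rewrite (points_mass_counting (SX w) (@measurable_half_open_cube R n)).
rewrite /lower_count; set A := mkset _.
have finQ := cube_finite (SX w).
have AQ : A `<=` support (X w) `&` Q by move=> x [].
have finA := sub_finite_set AQ finQ.
rewrite /counting !asboolT// indicE.
case: (boolP (w \in _)) => [/set_mem/=|_]; last first.
  rewrite sube0 lee_fin ler_nat; apply: finmap.fsubset_leq_card.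
  by rewrite -fset_set_sub.
move=> /(far_matched_matching_distance r (points_of_config (SX w)) gw).
move=> [x [Sx Qx] xr].
have AxQ : x |` A `<=` support (X w) `&` Q by move=> y [->|/AQ].
have finAx : finite_set (x |` A) by apply: sub_finite_set AxQ finQ.
rewrite -EFinB lee_fin lerBrDr natr1 ler_nat.
have : finmap.fsubset (fset_set (x |` A)) (fset_set (support (X w) `&` Q)).
  by rewrite -fset_set_sub.
move=> /finmap.fsubset_leq_card; apply: leq_trans.
rewrite fset_setU1// finmap.cardfsU1 in_fset_set// memNset//.
by move=> [_ _]; rewrite leNgt xr.
Qed.

(** On [far_matched r] at least one point of the cube escapes [lower_count r]. Moving the indicator
    to the right leaves a measurable majorant [g] of the count, and monotonicity of the lower
    integral suffices. *)
Lemma lower_count_integral_le r :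
  (\int[P]_w lower_count r w + P (X @^-1` far_matched r) <= \int[P]_w X w Q)%E.
Proof.
have mfar := measurable_process_event (@measurable_far_matched R n r).
have mQ := measurable_eval_process (@measurable_half_open_cube R n).
pose g w := (X w Q - (\1_(X @^-1` far_matched r) w)%:E)%E.
have mind : measurable_fun setT (EFin \o \1_(X @^-1` far_matched r) : Omega -> \bar R).
  exact/measurable_EFinP.
have mg : measurable_fun setT g by exact: emeasurable_funB.
have g0 w : (0 <= g w)%E.
  rewrite /g indicE; case: (boolP (w \in _)) => [/set_mem fw|_]; last by rewrite sube0.
  have [x [Sx Qx] _] := (far_matchedP r (SX w)).1 fw.
  rewrite sube_ge0//.
  exact: points_mass_ge1 (SX w) (@measurable_half_open_cube R n) Sx Qx.
have -> : P (X @^-1` far_matched r) =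
    (\int[P]_w (\1_(X @^-1` far_matched r) w)%:E)%E.
  by rewrite integral_indic// setIT.
have -> : (\int[P]_w X w Q = \int[P]_w g w +
    \int[P]_w (\1_(X @^-1` far_matched r) w)%:E)%E.
  rewrite -ge0_integralD//.
  by apply: eq_integral => w _; rewrite /g subeK.
apply: leeD => //; apply: ae_ge0_le_lower_integral => //.
by apply: filterS X_good => w gw; exact: lower_count_le.
Qed.

Lemma lower_count0 : (\int[P]_w lower_count 0 w)%E = 0%E.
Proof.
apply/eqP; rewrite eq_le integral_ge0 ?andbT//.
rewrite -(integral0 P setT); apply: ae_ge0_le_lower_integral => //.
apply: filterS X_good => w [[off _] _]; rewrite /lower_count.
rewrite (_ : mkset _ = set0) ?measure0//.
apply/seteqP; split => // x [Sx _ le]; have [_ _ xx _] := off x Sx id.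
apply: xx; apply/esym/enorm_sub_eq0/eqP.
by rewrite eq_le le sqrtr_ge0.
Qed.

Hypothesis X_inv : translation_invariant P X.
Hypothesis X_int : (intensity P X < +oo)%E.
Context {dS : measure_display} {Omegas : measurableType dS}.
Context (Ps : probability Omegas R) (D : {RV Ps >-> R}).
Hypothesis D_cdf : forall r : R, 0 <= r ->
  Ps [set w | D w <= r] = (typical_distance_cdf P X M r)%:E.

Local Notation lam := (\int[P]_w X w Q)%E.

Lemma measurable_unit_cube : measurable (@unit_cube R n).
Proof.
rewrite (_ : unit_cube (n := n) = \bigcap_(i in [set: 'I_n])
    ((fun x : E => x ord0 i : R) @^-1` `[0, 1]%classic)).
  apply: fin_bigcap_measurable => // i _.
  by rewrite -[Y in measurable Y]setTI; exact: measurable_Rd_coord.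
apply/seteqP; split => x /= H i; last by have := H i I; rewrite /= in_itv.
by move=> _; rewrite /= in_itv; exact: H.
Qed.

Lemma cube_intensity_fin : lam \is a fin_num.
Proof.
rewrite ge0_fin_numE; last exact: integral_ge0.
apply: le_lt_trans X_int; apply: ge0_le_integral => //.
- exact: measurable_eval_process (@measurable_half_open_cube R n).
- exact: measurable_eval_process measurable_unit_cube.
- move=> w _; apply: le_measure; rewrite ?inE.
  + exact: measurable_half_open_cube.
  + exact: measurable_unit_cube.
  + by move=> x Qx i; have /andP[-> /ltW ->] := Qx i.
Qed.

Lemma measurable_RV_le r : measurable [set w | D w <= r].
Proof.
have := measurable_funPT D measurableT _ (measurable_itv `]-oo, r]).
rewrite setTI /preimage.
by under [Y in measurable Y -> _]eq_set do rewrite /= in_itv.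
Qed.

(** Since [0^-1 = 0], a zero intensity would turn [D_cdf] into [Ps [set w | D w <= r] = 0] for all
    [r >= 0], which is impossible for a probability. *)
Lemma cube_intensity_gt0 : 0 < fine lam.
Proof.
rewrite lt_neqAle fine_ge0 ?integral_ge0// andbT eq_sym.
apply/negP => /eqP lam0.
suff : Ps setT = 0%E by rewrite probability_setT => /eqP; rewrite eqe oner_eq0.
apply/negligibleP => //.
rewrite (_ : setT = \bigcup_k [set w | D w <= k%:R]); last first.
  apply/seteqP; split => // w _; exists (Num.truncn (D w)).+1 => //=.
  by rewrite ltW// truncnS_gt.
apply: negligible_bigcup => k; apply/(negligibleP _ (measurable_RV_le k%:R)).
by rewrite [LHS]D_cdf// /typical_distance_cdf lam0 invr0 mul0r.
Qed.

Lemma cube_intensityE : lam = (fine lam)%:E.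
Proof. by rewrite fineK// cube_intensity_fin. Qed.

Lemma far_matched_le r : 0 <= r ->
  (P (X @^-1` far_matched r) <= lam * Ps [set w | (r < D w)%R])%E.
Proof.
move=> r0; have mr := measurable_RV_le r.
have -> : [set w | r < D w] = ~` [set w | D w <= r].
  by apply/seteqP; split => w /=; rewrite ltNge => /negP.
rewrite probability_setC// D_cdf// /typical_distance_cdf -/(lower_count r).
have := lower_count_integral_le r.
set I := (\int[P]_w lower_count r w)%E; set p := P _ => Ip.
have pfin : p \is a fin_num.
  exact: fin_num_measure (measurable_process_event (@measurable_far_matched R n r)).
have I0 : (0 <= I)%E by apply: integral_ge0.
have Ifin : I \is a fin_num.
  rewrite ge0_fin_numE// (le_lt_trans _ (_ : lam < +oo)%E)//.
    by apply: le_trans Ip; rewrite leeDl// measure_ge0.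
  by rewrite -ge0_fin_numE ?cube_intensity_fin// integral_ge0.
have l0 := cube_intensity_gt0.
move: Ip; rewrite cube_intensityE -(fineK Ifin) -(fineK pfin) /=.
rewrite -EFinD -EFinB -EFinM !lee_fin => Ip.
by rewrite mulrBr mulr1 mulVKf ?gt_eqF// lerBrDl.
Qed.

(** No point is its own partner, so the distribution function vanishes at 0. This allows the moment
    of [D] to be computed from [Num.max 0 (D w)]. *)
Lemma D_gt0 : {ae Ps, forall w, 0 < D w}.
Proof.
have m0 := measurable_RV_le 0.
exists [set w | D w <= 0]; split => // [|w /= /negP]; last by rewrite leNgt.
rewrite D_cdf// /typical_distance_cdf -/(lower_count 0) lower_count0.
by rewrite mulr0.
Qed.

End competitors.

(** * Finitely many competitors for the cube *)

Section finitely_many_competitors.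
Context {R : realType} {n : nat} {dO : measure_display}.
Context {Omega : measurableType dO} (P : probability Omega R).
Context (X : Omega -> measures (Rd R n) R) (M : Omega -> measures (upair R n) R).
Local Notation E := (Rd R n).
Local Notation Q := (@half_open_cube R n).
Hypothesis X_pp : Rd_point_process X.
Hypothesis X_good : {ae P, forall w, matched_at X M w}.

(** Since [y - intv k] and [x] lie in the same unit cube, the sup norm of [intv k] is at most that
    of [y - x] plus 1, and the Euclidean norm dominates the sup norm. The cut-off at 0 is there
    because [D_cdf] speaks of nonnegative radii. *)
Lemma far_matched_translate (w : Omega) (k : 'rV[int]_n) (x y : E) :
  matched_at X M w -> half_open_cube (y - intv k) -> half_open_cube x ->
  support (X w) y -> enorm (y - x) < matching_distance (M w) y ->
  far_matched (Num.max 0 (`|intv k : E| - 1)) (translate (- intv k) (X w)).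
Proof.
move=> [off _] Qy Qx Sy lt.
have SX := point_configP (X_pp.2 w).
apply/(far_matchedP _ (points_translate (- intv k) SX)).
exists (y - intv k); first by split => //; exists y.
move=> z j [c le].
have [z0 Sz0 zE] : (shift (- intv k) @` support (X w)) z.
  by move: c; case: (j) => [//|?] [].
subst z.
have [_ yz] := certified_sound (@enormC R n) (fun _ _ => False_ind _) off
  (certified_shift c).
move: le; rewrite /shift /= opprD opprK addrACA addNr addr0 -yz.
rewrite -/(matching_distance (M w) y) leNgt => /negP; apply.
apply: le_lt_trans lt; rewrite ge_max sqrtr_ge0 /=.
have [->|/norm_le_coord[i ->]] := eqVneq (intv k : E) 0.
  by rewrite normr0 sub0r (le_trans _ (sqrtr_ge0 _))// lerN10.
apply: le_trans (coord_le_enorm _ i); rewrite !mxE.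
have := Qy i; have := Qx i; rewrite !mxE => /andP[x0 x1] /andP[y0 y1].
rewrite lerBlDr.
rewrite (_ : (k ord0 i)%:~R = (y ord0 i - x ord0 i) +
  (x ord0 i - (y ord0 i - (k ord0 i)%:~R))); last by ring.
apply: (le_trans (ler_normD _ _)); rewrite lerD2l.
by rewrite ler_norml; apply/andP; split; lra.
Qed.

Hypothesis X_inv : translation_invariant P X.
Hypothesis X_int : (intensity P X < +oo)%E.
Context {dS : measure_display} {Omegas : measurableType dS}.
Context (Ps : probability Omegas R) (D : {RV Ps >-> R}).
Hypothesis D_cdf : forall r : R, 0 <= r ->
  Ps [set w | D w <= r] = (typical_distance_cdf P X M r)%:E.
Hypothesis D_moment : (\int[Ps]_w (Num.max 0 (D w) ^+ n)%:E < +oo)%E.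

Context (g : nat -> option 'rV[int]_n).
Hypothesis g_inj : forall i j k, g i = Some k -> g j = Some k -> i = j.
Hypothesis g_onto : forall k, exists j, g j = Some k.

Let rad (k : 'rV[int]_n) : R := Num.max 0 (`|intv k : Rd R n| - 1).

Let far_event (j : nat) : set Omega :=
  if g j is Some k then
    (fun w => translate (- intv k) (X w)) @^-1` far_matched (rad k)
  else set0.

Lemma measurable_translate_process (t : E) :
  measurable_fun setT (fun w => translate t (X w)).
Proof.
apply: measurable_fun_measures => A mA.
apply: (measurable_eval_process X_pp).
by have := measurable_shift t measurableT mA; rewrite setTI.
Qed.

Let measurable_far_event j : measurable (far_event j).
Proof.
rewrite /far_event; case: (g j) => [k|//].
have := measurable_translate_process (- intv k) measurableT
  (@measurable_far_matched R n (rad k)).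
by rewrite setTI.
Qed.

Let far_event_sum : (\sum_(j <oo) P (far_event j) < +oo)%E.
Proof.
pose a j (w : Omegas) : \bar R :=
  if g j is Some k then ((rad k < D w)%R%:R)%:E else 0%E.
have mDr r : measurable [set w | r < D w].
  rewrite (_ : mkset _ = ~` [set w | D w <= r]).
    by apply: measurableC; exact: measurable_RV_le.
  by apply/seteqP; split => w /=; rewrite ltNge => /negP.
have aE k : (fun w => ((rad k < D w)%R%:R)%:E) =
    (EFin \o \1_[set w | rad k < D w]).
  by apply/funext => w /=; rewrite indicE; congr ((_ _)%:R%:E); apply/idP/idP;
    rewrite inE.
have ma j : measurable_fun setT (a j).
  rewrite /a; case: (g j) => [k|]; last exact: measurable_cst.
  by rewrite aE; apply/measurable_EFinP; exact: measurable_indic.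
have a0 j w : (0 <= a j w)%E by rewrite /a; case: (g j).
pose lam := (\int[P]_w X w Q)%E.
have le j : (P (far_event j) <= lam * \int[Ps]_w a j w)%E.
  rewrite /far_event /a; case: (g j) => [k|]; last by rewrite measure0 integral0 mule0.
  rewrite aE integral_indic// setIT.
  have -> : P ((fun w => translate (- intv k) (X w)) @^-1` far_matched (rad k)) =
      P (X @^-1` far_matched (rad k)).
    exact: (X_inv (- intv k) (@measurable_far_matched R n (rad k))).
  have rad0 : 0 <= rad k by rewrite le_max lexx.
  exact: (far_matched_le X_pp X_good X_int D_cdf rad0).
apply: (@le_lt_trans _ _ (lam * \sum_(j <oo) \int[Ps]_w a j w)%E).
  rewrite /lam (cube_intensityE X_pp X_int) -nneseriesZl; last first.
    by move=> j _; exact: integral_ge0.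
  apply: lee_nneseries => [j _ _|j _]; first exact: measure_ge0.
  by rewrite -(cube_intensityE X_pp X_int); exact: le.
rewrite -integral_nneseries//.
have lamfin := cube_intensity_fin X_pp X_int.
apply: lte_mul_pinfty => //; first exact: integral_ge0.
pose b (w : Omegas) : \bar R := ((7 ^+ n)%:E * (1 + (Num.max 0 (D w) ^+ n)%:E))%E.
have mb0 : measurable_fun setT (fun w => (Num.max 0 (D w) ^+ n)%:E : \bar R).
  apply/measurable_EFinP/measurable_funX/measurable_maxr => //.
have b0 w : (0 <= b w)%E.
  by rewrite /b -EFinD -EFinM lee_fin mulr_ge0// addr_ge0// exprn_ge0// le_max lexx.
have mb : measurable_fun setT b.
  by apply: measurable_funeM; exact: emeasurable_funD.
apply: (@le_lt_trans _ _ (\int[Ps]_w b w)%E).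
  apply: ge0_le_integral => //.
  - by move=> w _; exact: nneseries_ge0.
  - exact: ge0_emeasurable_sum.
  - move=> w _; rewrite /b -EFinD -EFinM; exact: lattice_sum_le.
rewrite ge0_integralZl//; last 2 first.
  exact: emeasurable_funD.
  by move=> w _; rewrite -EFinD lee_fin addr_ge0// exprn_ge0// le_max lexx.
rewrite lte_mul_pinfty// ?lee_fin ?exprn_ge0//.
rewrite ge0_integralD//; last first.
  by move=> w _; rewrite lee_fin exprn_ge0// le_max lexx.
apply: lte_add_pinfty => //.
rewrite integral_cst// mul1e.
exact: le_lt_trans (probability_le1 Ps measurableT) (ltry _).
Qed.

Lemma ae_finitely_many_competitors : {ae P, forall w,
  finite_set [set y | support (X w) y /\
    exists x, half_open_cube x /\ enorm (y - x) < matching_distance (M w) y]}.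
Proof.
have mls : measurable (lim_sup_set far_event).
  by apply: bigcapT_measurable => k; exact: bigcup_measurable.
have := measure0_ae_not mls (lim_sup_set_cvg0 measurable_far_event far_event_sum).
apply: filterS2 X_good => w gw nls.
have [N HN] : exists N, forall j, (N <= j)%N -> ~ far_event j w.
  apply: contrapT => H; apply: nls => N _.
  apply: contrapT => H'; apply: H; exists N => j Nj Fj; apply: H'.
  by exists j.
have SX := point_configP (X_pp.2 w).
(* Cells with index at least [N] contain no competitor, and each remaining cell lies in a ball,
   which holds finitely many points. *)
pose B j : set E := if g j is Some k then
  [set y | support (X w) y /\ `|y - intv k| <= 1] else set0.
apply: (@sub_finite_set _ _ (\bigcup_(j in `I_N) B j)); last first.
  apply: bigcup_finite => // j _; rewrite /B; case: (g j) => // k.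
  exact: points_bounded_finite SX.
move=> y [Sy [x [Qx lt]]].
pose k : 'rV[int]_n := \row_i Num.floor (y ord0 i).
have Qy : half_open_cube (y - intv k).
  move=> i; rewrite !mxE subr_ge0 ltrBlDl.
  by rewrite ge_floor -[1]/(1%:~R) -intrD addrC addrC lt_succ_floor.
have [j gj] := g_onto k; exists j; last first.
  rewrite /B gj; split => //.
  rewrite leNgt; apply/negP => y1.
  have /norm_le_coord[i yi] : y - intv k != 0 by rewrite -normr_gt0 (lt_trans ltr01 y1).
  have /andP[z0 z1] := Qy i.
  by move: y1; rewrite yi ger0_norm// ltNge ltW.
rewrite /= ltnNge; apply/negP => /HN; apply; rewrite /far_event gj.
exact: far_matched_translate lt.
Qed.

End finitely_many_competitors.

(** * Deletion *)

Section deletion.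
Context {R : realType} {n : nat}.
Local Notation E := (Rd R n).
Local Notation edist := (fun x y : E => enorm (x - y)).
Implicit Types (mu : measures E R) (S F A : set E).

Definition restrict mu A (mA : measurable A) : measures E R := mrestr mu mA.

(** Deleting by ball index makes every finite deletion a composition of deterministic measurable
    maps, of which there are countably many, so null events can be avoided for all of them at
    once. *)
Definition delete (i : nat) mu : measures E R :=
  if `[< occupied i mu >] then restrict mu (measurableC (@measurable_rball R n i))
  else mu.

Lemma measurable_delete i : measurable_fun setT (delete i).
Proof.
apply: measurable_fun_measures => A mA _ B mB; rewrite setTI.
have mo := @measurable_occupied R n i.
have mAi : measurable (A `&` ~` (rball i : set E)).
  exact: measurableI mA (measurableC (@measurable_rball R n i)).
rewrite (_ : _ @^-1` _ =
  ([set mu | occupied i mu] `&`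
     (fun mu => mu (A `&` ~` (rball i : set E))) @^-1` B) `|`
  (~` [set mu | occupied i mu] `&` (fun mu => mu A) @^-1` B)).
  apply: measurableU; apply: measurableI.
  - exact: mo.
  - by have := measurable_eval mAi measurableT mB; rewrite setTI.
  - exact: measurableC.
  - by have := measurable_eval mA measurableT mB; rewrite setTI.
apply/seteqP; split => mu /=; rewrite /delete.
  by case: ifPn => /asboolP oc h; [left|right].
by case: ifPn => /asboolP oc [[]|[]].
Qed.

Lemma delete_points S mu i x : points_of S mu -> S `&` rball i = [set x] ->
  points_of (S `\ x) (delete i mu).
Proof.
move=> Smu Sx; rewrite /delete asboolT; last first.
  exact: (points_mass1 Smu (@measurable_rball R n i) Sx).
rewrite (_ : S `\ x = S `&` ~` rball i); first exact: points_mrestr.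
apply/seteqP; split => y /= [Sy yx]; split => //.
  by move=> iy; apply: yx; have /seteqP[/(_ y (conj Sy iy))] := Sx.
by move=> yE; apply: yx; rewrite yE; have /seteqP[_ /(_ x erefl)[]] := Sx.
Qed.

Lemma delete_unoccupied mu i : ~ occupied i mu -> delete i mu = mu.
Proof. by move=> o; rewrite /delete asboolF. Qed.

Lemma delete_config mu i : point_config mu -> point_config (delete i mu).
Proof.
move=> /point_configP Smu; have [oc|oc] := pselect (occupied i mu).
  exact: points_of_config (delete_points Smu (occupied_points Smu oc)).
by rewrite delete_unoccupied//; exact: points_of_config Smu.
Qed.

Lemma delete_mass S mu i A : points_of S mu -> occupied i mu -> measurable A ->
  mu A = (delete i mu A + \d_(loc i mu) A)%E.
Proof.
move=> Smu o mA; have Si := occupied_points Smu o.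
have Sd := delete_points Smu Si.
have := points_add_point Sd (fun h : (S `\ loc i mu) (loc i mu) => h.2 erefl).
rewrite setD1K; last by have /seteqP[_ /(_ _ erefl)[]] := Si.
move=> Sa; rewrite (points_mass Smu mA) -(points_mass Sa mA).
by rewrite /add_point /= /measure_add /= /msum !big_ord_recl big_ord0 adde0.
Qed.

Lemma delete_finite S mu F : points_of S mu -> finite_set F ->
  exists s : seq nat, points_of (S `\` F) (foldr delete mu s).
Proof.
move=> Smu /finite_seqP[xs ->]; elim: xs => [|x xs [s IH]].
  by exists [::]; rewrite (_ : [set` [::]] = set0) ?setD0//; apply/seteqP; split.
have -> : S `\` [set` x :: xs] = (S `\` [set` xs]) `\ x.
  apply/seteqP; split => y /=; rewrite inE.
    by move=> [Sy /negP]; rewrite negb_or => /andP[/eqP yx /negP ys].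
  by move=> [[Sy /negP ys] /eqP yx]; split => //; apply/negP; rewrite negb_or yx.
have [Sx|Sx] := pselect ((S `\` [set` xs]) x).
  have [i Si] := rball_isolates IH Sx.
  by exists (i :: s); exact: delete_points IH Si.
exists s; rewrite (_ : _ `\ x = S `\` [set` xs])//.
apply/seteqP; split => [y [] //|y Sy]; split => // /= yx.
by apply: Sx; rewrite -yx.
Qed.

Lemma deletion_unmatched S mu m x : points_of S mu ->
  stable_matching_off edist S set0 m -> S x ->
  finite_set [set y | S y /\ enorm (y - x) < enorm (y - m y)] ->
  exists s : seq nat, unmatched (foldr delete mu s).
Proof.
move=> Smu [mS mst _] Sx; set H := mkset _ => finH.
pose F := (H `|` m @` H) `\ x.
have finF : finite_set F.
  apply: finite_setD; rewrite finite_setU; split => //; exact: finite_image.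
have [s Ss] := delete_finite Smu finF; exists s.
apply/(unmatchedP Ss); exists x; first by split => // -[_]; exact.
have mS' a : S a -> [/\ S (m a), m a <> a & m (m a) = a].
  by move=> Sa; have [] := mS a Sa id.
(* As [x] is at distance 0 from itself it belongs to [H], so its partner is deleted, and no
   surviving point loses its partner. *)
have Hx : H x.
  split => //; have [_ mx _] := mS' x Sx.
  rewrite lt_neqAle eq_sym (proj2 (enorm_sub_eq0 x x) erefl) sqrtr_ge0 andbT.
  by apply/eqP => /enorm_sub_eq0 /esym.
have off : stable_matching_off edist (S `\` F) [set x] m.
  split.
  - move=> a [Sa Fa] ax; have [Sma maa mma] := mS' a Sa.
    have Ha : ~ H a by move=> Ha; apply: Fa; split => //; left.
    have mHa : ~ (m @` H) a by move=> ha; apply: Fa; split => //; right.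
    split=> //; last by move=> max; apply: mHa; exists x => //; rewrite -max.
    split=> // -[[Hma|[h Hh mh]] _]; first by apply: mHa; exists (m a).
    apply: Ha; have [_ _ <-] := mS' a Sa; rewrite -mh.
    by have [_ _ ->] := mS' h Hh.1.
  - by move=> a b [Sa _] [Sb _] _ _; exact: mst.
  - move=> u b [Sb Fb] bx -> /=; rewrite leNgt; apply/negP => lt.
    by apply: Fb; split => //; left.
move=> y k c; have [] := certified_sound (@enormC R n) _ off c.
  by move=> u v -> ->.
by move=> /(_ erefl).
Qed.

Lemma measurable_fun_select d (T : measurableType d) d' (T' : measurableType d')
    (idx : T -> nat) (f : nat -> T -> T') :
  (forall j, measurable [set t | idx t = j]) ->
  (forall j, measurable_fun setT (f j)) ->
  measurable_fun setT (fun t => f (idx t) t).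
Proof.
move=> mi mf _ B mB; rewrite setTI.
rewrite (_ : _ @^-1` _ = \bigcup_j ([set t | idx t = j] `&` f j @^-1` B)).
  apply: bigcupT_measurable => j; apply: measurableI => //.
  by have := mf j measurableT B mB; rewrite setTI.
apply/seteqP; split => t /= => [Bt|[j _ [-> //]]].
by exists (idx t).
Qed.

Context {dO : measure_display} {Omega : measurableType dO}.
Context (P : probability Omega R) (X : Omega -> measures E R).
Hypothesis X_pp : Rd_point_process X.
Hypothesis X_nonempty : {ae P, forall w, support (X w) !=set0}.
Hypothesis X_del : deletion_tolerant P X.

(** Tolerance requires [Z] to be a point of [X] almost surely, but [rball i] may not isolate one. So
    [Y] deletes the point in the first occupied ball of the list [i, 0, 1, 2, ...], and [delete i]
    applied to [X] agrees with [Y] or with [X]. *)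
Lemma delete_null i (A : set (measures E R)) : measurable A ->
  P (X @^-1` A) = 0%E -> P ((delete i \o X) @^-1` A) = 0%E.
Proof.
move=> mA A0.
pose c j := if j is j'.+1 then j' else i.
have idxP w : exists j, (occupied (c j) (X w) /\
      forall l, (l < j)%N -> ~ occupied (c l) (X w)) \/
    (j = 0%N /\ forall l, ~ occupied (c l) (X w)).
  have [ex|nex] := pselect (exists j, `[< occupied (c j) (X w) >]).
    exists (ex_minn ex); case: ex_minnP => j /asboolP qj jmin; left; split => //.
    by move=> l lj /asboolP /jmin; rewrite leqNgt lj.
  by exists 0%N; right; split => // l /asboolP o; apply: nex; exists l.
have /choice[idx Hidx] := idxP.
have idx_uniq w j : (occupied (c j) (X w) /\
      forall l, (l < j)%N -> ~ occupied (c l) (X w)) \/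
    (j = 0%N /\ forall l, ~ occupied (c l) (X w)) -> idx w = j.
  case: (Hidx w) => [[q1 l1]|[-> n1]] [[q2 l2]|[-> n2]] //.
  - by case: (ltngtP (idx w) j) => // lt; [have := l2 _ lt|have := l1 _ lt].
  - by have := n2 _ q1.
  - by have := n1 _ q2.
have mocc j : measurable [set w | occupied (c j) (X w)].
  by have := X_pp.1 measurableT _ (@measurable_occupied R n (c j)); rewrite setTI.
have midx j : measurable [set w | idx w = j].
  rewrite (_ : mkset _ = [set w | (occupied (c j) (X w) /\
      forall l, (l < j)%N -> ~ occupied (c l) (X w))] `|`
    [set w | (j = 0%N /\ forall l, ~ occupied (c l) (X w))]); last first.
    apply/seteqP; split => w /=; last exact: idx_uniq.
    by move=> <-; exact: Hidx.
  apply: measurableU.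
    apply: measurable_comp_and => //.
    apply: measurable_comp_forall => l.
    apply: measurable_comp_imply; first exact: measurable_comp_cst.
    exact: measurable_comp_not.
  apply: measurable_comp_and; first exact: measurable_comp_cst.
  by apply: measurable_comp_forall => l; exact: measurable_comp_not.
pose Z w := loc (c (idx w)) (X w).
pose Y w := delete (c (idx w)) (X w).
have mZ : measurable_fun setT Z.
  apply: (@measurable_fun_select _ _ _ _ idx (fun j w => loc (c j) (X w))) => // j.
  exact: measurableT_comp (measurable_loc (c j)) X_pp.1.
have mY : measurable_fun setT Y.
  apply: (@measurable_fun_select _ _ _ _ idx (fun j w => delete (c j) (X w))) => // j.
  exact: measurableT_comp (measurable_delete (c j)) X_pp.1.
have occ_idx w : support (X w) !=set0 -> occupied (c (idx w)) (X w).
  move=> [x Sx]; have [j [qj _ _]] := points_occupied (point_configP (X_pp.2 w)) Sx.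
  by case: (Hidx w) => [[]//|[_ /(_ j.+1)]].
have Zsupp : {ae P, forall w, support (X w) (Z w)}.
  apply: filterS X_nonempty => w /occ_idx o.
  by have /seteqP[_ /(_ _ erefl)[]] := occupied_points (point_configP (X_pp.2 w)) o.
have Ypp : Rd_point_process Y.
  by split => // w; apply: delete_config; exact: X_pp.2.
have YE : {ae P, forall w, forall B, measurable B ->
    Y w B = (X w B - \d_(Z w) B)%E}.
  apply: filterS X_nonempty => w /occ_idx o B mB.
  by rewrite (delete_mass (point_configP (X_pp.2 w)) o mB) addeK.
have Y0 := X_del mZ Zsupp Ypp YE mA A0.
have mXA : measurable (X @^-1` A).
  by have := X_pp.1 measurableT _ mA; rewrite setTI.
have mYA : measurable (Y @^-1` A) by have := mY measurableT _ mA; rewrite setTI.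
have mdA : measurable ((delete i \o X) @^-1` A).
  have := measurableT_comp (measurable_delete i) X_pp.1 measurableT mA.
  by rewrite setTI.
apply/(negligibleP _ mdA).
apply: (@negligibleS _ _ _ _ ((X @^-1` A) `|` (Y @^-1` A))).
  move=> w /= Aw; have [oc|oc] := pselect (occupied i (X w)); last first.
    by left; rewrite delete_unoccupied in Aw.
  by right; rewrite /Y (idx_uniq w 0%N)//; left.
by apply: negligibleU; [apply/(negligibleP _ mXA)|apply/(negligibleP _ mYA)].
Qed.

Lemma delete_seq_null (s : seq nat) (A : set (measures E R)) : measurable A ->
  P (X @^-1` A) = 0%E -> P ((fun w => foldr delete (X w) s) @^-1` A) = 0%E.
Proof.
elim: s A => [//|i s IH] A mA A0.
(* The outermost deletion is absorbed into the event, because tolerance is available for [X] and not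
   for the thinned process. *)
apply: (IH (delete i @^-1` A)).
  by have := measurable_delete i measurableT mA; rewrite setTI.
exact: delete_null.
Qed.

Lemma measurable_delete_seq (s : seq nat) :
  measurable_fun setT (fun w => foldr delete (X w) s).
Proof.
elim: s => [|i s IH]; first exact: X_pp.1.
exact: measurableT_comp (measurable_delete i) IH.
Qed.

Lemma ae_deleted_not_unmatched : P (X @^-1` unmatched) = 0%E ->
  {ae P, forall w, forall s : seq nat, ~ unmatched (foldr delete (X w) s)}.
Proof.
move=> U0; have mU := @measurable_unmatched R n.
have null s : P.-negligible ((fun w => foldr delete (X w) s) @^-1` unmatched).
  apply/negligibleP; last exact: delete_seq_null.
  by have := measurable_delete_seq s measurableT mU; rewrite setTI.
apply: (@negligibleS _ _ _ _ (\bigcup_j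
  ((fun w => foldr delete (X w) (odflt [::] (unpickle j))) @^-1` unmatched))).
  move=> w /= /existsNP[s /contrapT us].
  have e : odflt [::] (unpickle (pickle s)) = s by rewrite pickleK.
  by rewrite -e in us; exists (pickle s).
by apply: negligible_bigcup => j; exact: null.
Qed.

End deletion.

(** * Insertion *)

Section lebesgue_Rd_boxes.
Context {R : realType}.
Implicit Types (a b : nat -> R).

(** Bounds indexed by [nat] rather than ['I_n], so that dropping the first coordinate is a shift of
    sequences in the induction on [n]. *)
Definition open_box n a b : set (Rd R n) := 
  [set x | forall i : 'I_n, a i < x ord0 i < b i].

Lemma measurable_open_box n a b : measurable (@open_box n a b).
Proof.
rewrite (_ : open_box a b = \bigcap_(i in [set: 'I_n])
    ((fun x : Rd R n => x ord0 i : R) @^-1` `]a i, b i[%classic)).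
  apply: fin_bigcap_measurable => // i _.
  by rewrite -[Y in measurable Y]setTI; exact: measurable_Rd_coord.
apply/seteqP; split => x /= H i; last by have := H i I; rewrite /= in_itv.
by move=> _; rewrite /= in_itv; exact: H.
Qed.

Lemma lebesgue_open_box n a b : (forall i, a i < b i) ->
  (0 < lebesgue_Rd R n (@open_box n a b) < +oo)%E.
Proof.
elim: n a b => [|n IH] a b ab /=.
  by rewrite diracE mem_set ?lte01 ?ltry//; move=> -[].
rewrite /lebesgue_Rd_succ /pushforward.
rewrite (_ : _ @^-1` _ = `]a 0%N, b 0%N[%classic `*`
    @open_box n (fun i => a i.+1) (fun i => b i.+1)).
  have /andP[h1 h2] := IH (fun i => a i.+1) (fun i => b i.+1) (fun i => ab i.+1).
  rewrite product_measure1E//; last exact: measurable_open_box.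
  have li : lebesgue_measure `]a 0%N, b 0%N[%classic = (b 0%N - a 0%N)%:E :> \bar R.
    by rewrite lebesgue_measure_itv /= lte_fin ab -EFinB.
  rewrite [X in (_ < X * _ < _)%E]li mule_gt0 ?lte_fin ?subr_gt0//=.
  by rewrite lte_mul_pinfty// lee_fin subr_ge0 ltW.
apply/seteqP; split => -[x v] /= H.
  split.
    have := H (lshift n ord0 : 'I_(1 + n)).
    by rewrite /Rd_cons (@row_mxEl _ 1 1 n) mxE /= in_itv.
  by move=> i; have := H (rshift 1 i); rewrite /Rd_cons (@row_mxEr _ 1 1 n).
case: H => H0 H1 i; case: (@split_ordP 1 n i) => j ->.
  by rewrite /Rd_cons (@row_mxEl _ 1 1 n) mxE (ord1 j); move: H0; rewrite in_itv.
by rewrite /Rd_cons (@row_mxEr _ 1 1 n); exact: H1.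
Qed.

Lemma lebesgue_norm_ball_gt0 n (c : Rd R n) (e : R) (A : set (Rd R n)) :
  measurable A -> 0 < e -> [set x | `|x - c| < e] `<=` A ->
  (0 < lebesgue_Rd R n A)%E.
Proof.
move=> mA e0 cA.
pose f k := oapp (fun i : 'I_n => c ord0 i) 0 (insub k).
have fE (i : 'I_n) : f i = c ord0 i by rewrite /f valK.
pose B := @open_box n (fun k => f k - e) (fun k => f k + e).
have /andP[+ _] : (0 < lebesgue_Rd R n B < +oo)%E.
  by apply: lebesgue_open_box => i; rewrite ltrD2l gtrN.
move=> /lt_le_trans; apply; apply: le_measure; rewrite ?inE//.
  exact: measurable_open_box.
move=> x xf; apply: cA; apply/norm_ltP => // i.
by have := xf i; rewrite fE !mxE -ltr_distl.
Qed.

End lebesgue_Rd_boxes.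

Section product_probability.
Context d1 d2 (T1 : measurableType d1) (T2 : measurableType d2) (R : realType).
Context (P1 : probability T1 R) (P2 : probability T2 R).

Definition product_prob : set (T1 * T2) -> \bar R := (P1 \x P2)%E.

HB.instance Definition _ := Measure.on product_prob.

Let product_prob_setT : product_prob setT = 1%E.
Proof.
rewrite /product_prob -setXTT product_measure1E//.
by rewrite [X in (X * _)%E](probability_setT P1) [X in (_ * X)%E](probability_setT P2) mule1.
Qed.

HB.instance Definition _ :=
  Measure_isProbability.Build _ _ _ product_prob product_prob_setT.

End product_probability.

Section insertion.
Context {R : realType} {n : nat}.
Local Notation E := (Rd R n).
Local Notation leb := (lebesgue_Rd R n).
Implicit Types (mu : measures E R) (A : set (measures E R)).

Lemma measurable_add_point :
  measurable_fun setT (fun p : measures E R * E => add_point p.1 p.2).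
Proof.
apply: measurable_fun_measures => B mB.
rewrite (_ : (fun _ => _) = (fun p : measures E R * E => p.1 B + \d_(p.2) B)%E).
  apply: emeasurable_funD.
    exact: measurableT_comp (measurable_eval mB) measurable_fst.
  have mdB : measurable_fun setT (fun u : E => \d_u B : \bar R).
    exact: measurable_fun_dirac.
  exact: measurableT_comp mdB measurable_snd.
apply/funext => p.
by rewrite /add_point /= /measure_add /= /msum !big_ord_recl big_ord0 adde0.
Qed.

(** Positive volume means positive probability for a point inserted uniformly in some large cube;
    iterating allows for several insertions without naming the law of any of them. *)
Definition insertions A : set (measures E R) :=
  [set mu | (0 < leb [set u | A (add_point mu u)])%E].

Let add_set A : set (measures E R * E) := [set p | A (add_point p.1 p.2)].

Let measurable_add_set A : measurable A -> measurable (add_set A).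
Proof.
by move=> mA; have := measurable_add_point measurableT mA; rewrite setTI.
Qed.

Let xsection_add_set A mu : xsection (add_set A) mu = [set u | A (add_point mu u)].
Proof. by apply/seteqP; split => u; rewrite /xsection /= inE. Qed.

Lemma measurable_add_fiber A mu : measurable A ->
  measurable [set u | A (add_point mu u)].
Proof.
move=> mA; rewrite -xsection_add_set.
exact: measurable_xsection (measurable_add_set mA).
Qed.

Lemma measurable_insertions A : measurable A -> measurable (insertions A).
Proof.
move=> mA; have mf := measurable_fun_xsection leb (measurable_add_set mA).
have := emeasurable_fun_o_infty measurableT mf 0%E; rewrite setTI.
rewrite (_ : insertions A = [set mu | (0 < (leb \o xsection (add_set A)) mu)%E])//.
by apply/seteqP; split => mu /=; rewrite xsection_add_set.
Qed.

Context {dO : measure_display} {Omega : measurableType dO}.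
Context (P : probability Omega R) (X : Omega -> measures E R).
Hypothesis X_pp : Rd_point_process X.
Hypothesis X_ins : insertion_tolerant P X.

Let cube (K : nat) : set E := open_box (fun=> - K.+1%:R) (fun=> K.+1%:R).

Let measurable_cube K : measurable (cube K).
Proof. exact: measurable_open_box. Qed.

Let cube_leb K : (0 < leb (cube K) < +oo)%E.
Proof. by apply: lebesgue_open_box => _; rewrite gtrN. Qed.

(** The Dirac mass is only the fallback of [mnormalize] for mass zero or infinity, which [cube_leb]
    excludes. *)
Let unif (K : nat) : probability E R :=
  mnormalize (mrestr leb (measurable_cube K)) \d_(0 : E).

Let unifE K B : measurable B ->
  unif K B = (fine (leb (B `&` cube K)) / fine (leb (cube K)))%:E.
Proof.
move=> mB; have /andP[l0 loo] := cube_leb K.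
rewrite /unif /= /mnormalize /= /mrestr setTI gt_eqF//= lt_eqF//=.
rewrite EFinM fineK// ge0_fin_numE// (le_lt_trans _ loo)//.
by apply: le_measure; rewrite ?inE//; exact: measurableI.
Qed.

(** On the product of [Omega] with the uniform law on a cube, tolerance makes the insertion event
    null. By Fubini almost every fibre has no volume inside the cube, and countably many cubes
    exhaust the space. *)
Lemma insertions_null A : measurable A ->
  P (X @^-1` A) = 0%E -> P (X @^-1` insertions A) = 0%E.
Proof.
move=> mA A0.
have mX B : measurable B -> measurable (X @^-1` B).
  by move=> mB; have := X_pp.1 measurableT B mB; rewrite setTI.
have key K : {ae P, forall w,
    leb ([set u | A (add_point (X w) u)] `&` cube K) = 0%E}.
  pose P' : probability (Omega * E)%type R := product_prob P (unif K).
  pose Y : Omega * E -> measures E R := X \o fst.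
  have P'X B C : measurable B -> measurable C ->
      P' (B `*` C) = (P B * unif K C)%E.
    by move=> mB mC; exact: product_measure1E.
  have PT : P setT = 1%E by exact: probability_setT.
  have UT : unif K setT = 1%E by exact: probability_setT.
  have Ypp : Rd_point_process Y.
    by split=> [|w]; [exact: measurableT_comp X_pp.1 measurable_fst|exact: X_pp.2].
  have YX : same_law P' P Y X.
    move=> B mB; rewrite (_ : Y @^-1` B = (X @^-1` B) `*` setT).
      by rewrite P'X ?UT ?mule1//; exact: mX.
    by apply/seteqP; split => -[w u] //= [].
  have Uu : uniform_on P' (cube K) snd.
    move=> B mB; rewrite (_ : snd @^-1` B = setT `*` B).
      by rewrite P'X// PT mul1e unifE.
    by apply/seteqP; split => -[w u] //= [].
  have ind : independent P' Y snd.
    move=> B C mB mC.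
    rewrite (YX B mB) (_ : snd @^-1` C = setT `*` C); last first.
      by apply/seteqP; split => -[w u] //= [].
    rewrite (_ : _ `&` _ = (X @^-1` B) `*` C); last first.
      by apply/seteqP; split => -[w u] /= => [[? []]|[]].
    by rewrite !P'X ?PT ?mul1e//; exact: mX.
  have := X_ins (measurable_cube K) (cube_leb K) Ypp YX measurable_snd Uu ind mA A0.
  set B := _ @^-1` A => B0.
  have mB : measurable B.
    have m2 : measurable_fun setT (fun p : Omega * E => (X p.1, p.2)).
      by apply/measurable_fun_pairP; split => /=;
        [exact: measurableT_comp X_pp.1 measurable_fst|exact: measurable_snd].
    by have := measurableT_comp measurable_add_point m2 measurableT mA; rewrite setTI.
  have mfB := measurable_fun_xsection (unif K) mB.
  have : (\int[P]_w `|(unif K \o xsection B) w| = 0)%E.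
    rewrite -[RHS]B0; apply: eq_integral => w _.
    by rewrite gee0_abs.
  move=> /(ae_eq_integral_abs P measurableT mfB); apply: filterS => w /(_ I) /=.
  have -> : xsection B w = [set u | A (add_point (X w) u)].
    by apply/seteqP; split => u; rewrite /xsection /= inE.
  have mF := measurable_add_fiber (X w) mA.
  rewrite (unifE K mF) => /eqP; rewrite eqe mulf_eq0 invr_eq0.
  have /andP[l0 loo] := cube_leb K.
  have lfin : (leb ([set u | A (add_point (X w) u)] `&` cube K) < +oo)%E.
    apply: le_lt_trans loo; apply: le_measure; rewrite ?inE//.
    exact: measurableI.
  rewrite orbC gt_eqF /=; last by rewrite fine_gt0// l0.
  by move=> /eqP f0; rewrite -[LHS]fineK ?f0// ge0_fin_numE.
apply: ae_not_measure0; first exact: mX (measurable_insertions mA).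
have {}key : {ae P, forall w, forall K,
    leb ([set u | A (add_point (X w) u)] `&` cube K) = 0%E}.
  apply: (@negligibleS _ _ _ _ (\bigcup_K [set w |
      ~ leb ([set u | A (add_point (X w) u)] `&` cube K) = 0%E])).
    by move=> w /= /existsNP[K hK]; exists K.
  by apply: negligible_bigcup => K; exact: key.
apply: filterS key => w key; rewrite /preimage /insertions /=.
rewrite (_ : leb _ = 0%E) ?ltxx//.
have mF := measurable_add_fiber (X w) mA.
apply/(negligibleP _ mF).
rewrite (_ : mkset _ = \bigcup_K ([set u | A (add_point (X w) u)] `&` cube K)).
  apply: negligible_bigcup => K; apply/negligibleP; first exact: measurableI.
  exact: key.
apply/seteqP; split => [u Au|u [K _ []]//].
exists (Num.truncn `|u|) => //; split => // i /=.
have := coord_le_norm u i; rewrite -ltr_norml => /le_lt_trans; apply.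
exact: truncnS_gt.
Qed.

Lemma ae_inserted_not_unmatched : P (X @^-1` unmatched) = 0%E ->
  {ae P, forall w, forall k, ~ iter k insertions unmatched (X w)}.
Proof.
move=> U0.
have mk k : measurable (iter k insertions (@unmatched R n)).
  by elim: k => [|k IH] /=; [exact: measurable_unmatched|exact: measurable_insertions].
have null k : P (X @^-1` (iter k insertions unmatched)) = 0%E.
  by elim: k => [//|k IH] /=; exact: insertions_null.
apply: (@negligibleS _ _ _ _ (\bigcup_k (X @^-1` (iter k insertions unmatched)))).
  by move=> w /= /existsNP[k /contrapT uk]; exists k.
apply: negligible_bigcup => k; apply/negligibleP; last exact: null.
by have := X_pp.1 measurableT _ (mk k); rewrite setTI.
Qed.

End insertion.

(** * Stranding a point by insertions *)

Section insertion_strands.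
Context {R : realType} {n : nat}.
Local Notation E := (Rd R n).
Local Notation edist := (fun x y : E => enorm (x - y)).
Implicit Types (mu : measures E R) (S : set E) (A : set (measures E R)).

(** Balls have positive volume, so a choice of positions that tolerates displacements below [e] is
    enough. *)
Lemma insertions_balls A mu (cs : seq E) (e : R) : measurable A -> 0 < e ->
  (forall us : seq E, all2 (fun c u => `|u - c| < e) cs us ->
     A (foldl (@add_point R n) mu us)) ->
  iter (size cs) insertions A mu.
Proof.
move=> mA e0; elim: cs mu => [|c cs IH] mu H; first exact: (H [::]).
have mI k : measurable (iter k insertions A).
  by elim: k => [//|k IHk] /=; exact: measurable_insertions.
rewrite /= /insertions /=.
apply: (lebesgue_norm_ball_gt0 (measurable_add_fiber mu (mI (size cs))) e0 (c := c)).
move=> u uc /=; apply: IH => us cus.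
by apply: (H (u :: us)) => /=; rewrite uc.
Qed.

Lemma points_add_seq S mu (us : seq E) : points_of S mu -> uniq us ->
  (forall u, u \in us -> ~ S u) ->
  points_of (S `|` [set` us]) (foldl (@add_point R n) mu us).
Proof.
elim: us S mu => [|u us IH] S mu Smu.
  by rewrite (_ : [set` [::]] = set0) ?setU0//; apply/seteqP; split.
move=> /= /andP[uus us_uniq] disj.
have -> : S `|` [set` u :: us] = (u |` S) `|` [set` us].
  apply/seteqP; split => y /=; rewrite inE.
    by move=> [Sy|/orP[/eqP yu|yus]]; [left; right|left; left|right].
  by move=> [[->|Sy]|yus]; [right; rewrite eqxx|left|right; rewrite yus orbT].
apply: IH => //.
  by apply: points_add_point => //; apply: disj; rewrite inE eqxx.
move=> v vus [vu|]; first by move: uus; rewrite -vu vus.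
by apply: disj; rewrite inE vus orbT.
Qed.

Definition ones (t : R) : E := const_mx t.

Hypothesis n_gt0 : (0 < n)%N.

Lemma norm_ones t : `|ones t| = `|t|.
Proof.
apply/eqP; rewrite eq_le; apply/andP; split; last first.
  by have := coord_le_norm (ones t) (Ordinal n_gt0); rewrite mxE.
have [->|/norm_le_coord[i ->]] := eqVneq (ones t) 0; first by rewrite normr0.
by rewrite mxE.
Qed.

Lemma cube_hole S mu : points_of S mu -> exists (p : E) (e : R), 0 < e /\
  (forall y, S y -> e <= `|y - p|) /\ [set x | `|x - p| < e] `<=` @half_open_cube R n.
Proof.
move=> Smu; pose c := ones 2^-1.
have [e e0 He] := points_separated c Smu.
pose t := Num.min e 4^-1 / 2.
have m0 : 0 < Num.min e 4^-1 by rewrite lt_min e0 /=; lra.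
have t0 : 0 < t by rewrite /t; lra.
have te : t < e.
  by have : Num.min e 4^-1 <= e; [rewrite ge_min lexx|rewrite /t; lra].
have t4 : t <= 4^-1.
  by have : Num.min e 4^-1 <= 4^-1; [rewrite ge_min lexx orbT|rewrite /t; lra].
pose p := ones (2^-1 + t).
have pc : p - c = ones t by apply/rowP => i; rewrite !mxE addrC addKr.
have Sp : ~ S p.
  move=> Sp; have [pE|pE] := pselect (p = c).
    have := norm_ones t; rewrite -pc pE subrr normr0 => /eqP.
    by rewrite eq_sym normr_eq0 gt_eqF.
  have := He p Sp pE; rewrite pc norm_ones gtr0_norm// leNgt.
  by rewrite te.
have [e' e'0 He'] := points_separated p Smu.
exists p, (Num.min e' 4^-1); split; first by rewrite lt_min e'0 /=; lra.
split=> [y Sy|x /=].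
  by rewrite ge_min He'// => yp; apply: Sp; rewrite -yp.
rewrite lt_min => /andP[_ xp] i.
have := le_lt_trans (coord_le_norm (x - p) i) xp; rewrite !mxE ltr_norml.
by move=> /andP[h1 h2]; apply/andP; split; lra.
Qed.

Lemma finite_uniform_separation S mu (hs : seq E) : points_of S mu ->
  exists2 r : R, 0 < r & forall h y, h \in hs -> S y -> y <> h -> r <= `|y - h|.
Proof.
move=> Smu; elim: hs => [|h hs [r r0 IH]]; first by exists 1.
have [e e0 He] := points_separated h Smu.
exists (Num.min e r); first by rewrite lt_min e0.
move=> h' y; rewrite inE => /orP[/eqP -> Sy yh|h's Sy yh'].
  by rewrite ge_min He.
by rewrite ge_min orbC IH.
Qed.

(** Each point of [hs] is rematched with its companion in [vs]; all other old points keep their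
    partners, since [hs] is closed under [m]. Separation [4 * r], less two displacements below [r],
    keeps every other point at distance at least [2 * r] from a new pair of length below [r], so the
    members of these pairs prefer nobody else. *)
Lemma strand_stable S m (hs vs : seq E) (x p : E) (r : R) :
  stable_matching_off edist S set0 m ->
  uniq hs -> size vs = size hs ->
  (forall h, h \in hs -> S h /\ m h \in hs) ->
  (forall i, (i < size hs)%N ->
     [/\ `|nth 0 vs i - nth 0 hs i| < r, enorm (nth 0 vs i - nth 0 hs i) < r &
         nth 0 vs i <> nth 0 hs i]) ->
  (forall h y, h \in hs -> S y -> y <> h -> 4 * r <= `|y - h|) ->
  (forall y, S y -> 4 * r <= `|y - p|) -> `|x - p| < r ->
  (forall y, S y -> y \notin hs -> enorm (y - m y) <= enorm (y - x)) ->
  [/\ uniq (x :: vs), forall u, u \in x :: vs -> ~ S u &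
    exists m', stable_matching_off edist (S `|` [set` x :: vs]) [set x] m'].
Proof.
move=> [mS mst _] uhs szv hsS near sep psep xp pref.
have r0 : 0 < r by exact: le_lt_trans xp.
have far a b ha hb : ha \in hs -> (S hb /\ hb <> ha) \/ hb = p ->
    `|a - ha| < r -> `|b - hb| < r -> 2 * r <= `|b - a|.
  move=> hah hbh aha bhb.
  have : 4 * r <= `|hb - ha|.
    case: hbh => [[Sb ne]|->]; first exact: sep.
    by rewrite distrC; apply: psep; have [] := hsS _ hah.
  have : `|hb - ha| <= `|b - hb| + `|b - a| + `|a - ha|.
    rewrite -(subrKA a) (le_trans (ler_normD _ _))// lerD2r.
    by rewrite -(subrKA b) (le_trans (ler_normD _ _))// (distrC hb).
  lra.
have mem_hs i : (i < size hs)%N -> nth 0 hs i \in hs by exact: mem_nth.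
have mem_vs i : (i < size hs)%N -> nth 0 vs i \in vs.
  by rewrite -szv; exact: mem_nth.
have vsP v : v \in vs -> exists2 i, (i < size hs)%N & v = nth 0 vs i.
  by move=> vv; exists (index v vs); rewrite ?nth_index// -szv index_mem.
have hsP h : h \in hs -> exists2 i, (i < size hs)%N & h = nth 0 hs i.
  by move=> hh; exists (index h hs); rewrite ?nth_index// index_mem.
have h_h i : `|nth 0 hs i - nth 0 hs i| < r by rewrite subrr normr0.
have vS v : v \in vs -> ~ S v.
  move=> /vsP[i ih ->] Sv; have [n1 _ n3] := near i ih.
  have := sep _ _ (mem_hs i ih) Sv n3; lra.
have uvs : uniq vs.
  apply/(uniqP 0) => i j; rewrite !inE szv => ih jh eij.
  apply/eqP; rewrite -(nth_uniq 0 ih jh uhs); apply/eqP; apply: contrapT => ne.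
  have [n1 _ _] := near i ih; have [n2 _ _] := near j jh.
  have Sj := (hsS _ (mem_hs j jh)).1.
  have := far _ _ _ _ (mem_hs i ih) (or_introl (conj Sj (nesym ne))) n1 n2.
  by rewrite eij subrr normr0; lra.
have xS : ~ S x by move=> /psep; lra.
have xvs : x \notin vs.
  apply/negP => /vsP[i ih xE]; have [n1 _ _] := near i ih.
  have := far _ x _ p (mem_hs i ih) (or_intror erefl) n1 xp.
  by rewrite xE subrr normr0; lra.
have hsvs h : h \in hs -> h \notin vs.
  by move=> /hsS[Sh _]; apply/negP => /vS.
split; first by rewrite /= xvs.
  by move=> u; rewrite inE => /orP[/eqP ->//|]; exact: vS.
pose m' y := if y \in hs then nth 0 vs (index y hs)
  else if y \in vs then nth 0 hs (index y vs) else m y.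
have m'h i : (i < size hs)%N -> m' (nth 0 hs i) = nth 0 vs i.
  by move=> ih; rewrite /m' mem_hs// index_uniq.
have m'v i : (i < size hs)%N -> m' (nth 0 vs i) = nth 0 hs i.
  move=> ih; rewrite /m' mem_vs// index_uniq ?szv// ifF//.
  by apply/negP => /hsvs; rewrite mem_vs.
have m'S y : y \notin hs -> y \notin vs -> m' y = m y.
  by move=> /negPf yh /negPf yv; rewrite /m' yh yv.
pose S' := S `|` [set` x :: vs].
have S'P b : S' b -> [\/ S b, b = x | b \in vs].
  case=> [Sb|/=]; first by apply: Or31.
  by rewrite inE => /orP[/eqP bx|bv]; [apply: Or32|apply: Or33].
have pairP a : a \in hs \/ a \in vs -> exists2 i, (i < size hs)%N &
    (a = nth 0 hs i /\ m' a = nth 0 vs i) \/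
    (a = nth 0 vs i /\ m' a = nth 0 hs i).
  by case=> [/hsP|/vsP] [i ih ->]; exists i => //; [left|right]; split => //;
    [exact: m'h|exact: m'v].
have tight a : a \in hs \/ a \in vs ->
    enorm (a - m' a) < r /\
    forall b, S' b -> b <> a -> b <> m' a -> r <= enorm (a - b).
  move=> /pairP[i ih aE]; have [n1 n2 _] := near i ih; split.
    by case: aE => -[-> ->]; rewrite // enormC.
  move=> b S'b ba bm'a.
  have aha : `|a - nth 0 hs i| < r by case: aE => -[-> _].
  have bi : b <> nth 0 hs i /\ b <> nth 0 vs i.
    by case: aE => -[ae m'e]; rewrite -ae -m'e.
  suff : 2 * r <= `|b - a|.
    by move=> h; have := norm_le_enorm (b - a); rewrite enormC; lra.
  case: (S'P b S'b) => [Sb|->|/vsP[j jh bE]].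
  - apply: (far a b (nth 0 hs i) b (mem_hs i ih)) => //.
      by left; split => //; exact: bi.1.
    by rewrite subrr normr0.
  - by apply: (far a x (nth 0 hs i) p (mem_hs i ih)) => //; right.
  - have [nj _ _] := near j jh.
    apply: (far a b (nth 0 hs i) (nth 0 hs j) (mem_hs i ih)) => //; last by rewrite bE.
    left; split; first exact: (hsS _ (mem_hs j jh)).1.
    move=> /eqP; rewrite nth_uniq// => /eqP ji.
    by apply: bi.2; rewrite bE ji.
have split_hs a : S' a -> ~ [set x] a ->
    (a \in hs \/ a \in vs) \/ [/\ S a, a \notin hs, a \notin vs & m' a = m a].
  move=> /S'P[Sa|//|av] _; last by left; right.
  case: (boolP (a \in hs)) => [|ah]; first by left; left.
  have av : a \notin vs by apply/negP => /vS.
  by right; split => //; exact: m'S.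
have x_apart b : b \in hs \/ b \in vs -> x <> b.
  by case=> [/hsS[Sb _]|bv] xb; [apply: xS; rewrite xb|move: xvs; rewrite xb bv].
have S'x : S' x by right; rewrite /= inE eqxx.
have m'_pair a : a \in hs \/ a \in vs -> m' a \in hs \/ m' a \in vs.
  by move=> /pairP[i ih [[_ ->]|[_ ->]]]; [right; exact: mem_vs|left; exact: mem_hs].
exists m'; split.
- move=> a S'a xa; case: (split_hs a S'a xa) => [ap|[Sa ah av m'a]].
    have m'p := m'_pair a ap; split.
    + case: m'p => [/hsS[]|m'v']; first by left.
      by right; rewrite /= inE m'v' orbT.
    + by move=> /= m'x; apply: (x_apart _ m'p).
    + have [i ih] := pairP a ap; have [_ _ n3] := near i ih.
      by case=> -[-> ->] //; exact/nesym.
    + have [i ih] := pairP a ap.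
      by case=> -[-> ->]; [exact: m'v|exact: m'h].
  have [Sma _ maa mma] := mS a Sa id.
  have mah : m a \notin hs.
    by apply/negP => /hsS[_]; rewrite mma (negPf ah).
  have mav : m a \notin vs by apply/negP => /vS.
  rewrite m'a; split => //; first by left.
    by move=> /= mx; apply: xS; rewrite -mx.
  by rewrite m'S.
- move=> a b S'a S'b xa xb ab [lt1 lt2].
  case: (split_hs a S'a xa) => [ap|[Sa ah av m'a]].
    have [t1 t2] := tight a ap; have [bm|bm] := pselect (b = m' a).
      by move: lt1; rewrite -bm ltxx.
    by have := t2 b S'b (nesym ab) bm; lra.
  case: (split_hs b S'b xb) => [bp|[Sb bh bv m'b]].
    have [t1 t2] := tight b bp; have [am|am] := pselect (a = m' b).
      by move: lt2; rewrite -am enormC ltxx.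
    by have := t2 a S'a ab am; rewrite enormC; lra.
  by apply: (mst a b Sa Sb id id ab); rewrite -m'a -m'b.
- move=> u b S'b xb -> /=.
  case: (split_hs b S'b xb) => [bp|[Sb bh bv ->]]; last exact: pref.
  have [t1 t2] := tight b bp.
  by rewrite (le_trans (ltW t1))// t2//; apply: x_apart => //; exact: m'_pair.
Qed.

(** The inserted [x] is known only to lie in a small ball, so the finite set covers the competitors
    for all positions in the cube, and the companions are placed without reference to the exact
    [x]. *)
Lemma insertion_unmatched S mu m : points_of S mu ->
  stable_matching_off edist S set0 m ->
  finite_set [set y | S y /\
    exists x, half_open_cube x /\ enorm (y - x) < enorm (y - m y)] ->
  exists k, iter k insertions unmatched mu.
Proof.
move=> Smu off; set H := mkset _ => finH.
have [mS _ _] := off.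
have finF : finite_set (H `|` m @` H).
  by rewrite finite_setU; split => //; exact: finite_image.
have /finite_seqP[hs0 hs0E] := finF.
pose hs := undup hs0.
have hsE y : y \in hs <-> H y \/ (m @` H) y.
  by rewrite mem_undup; have := congr1 (@^~ y) hs0E => /= <-.
have hsS h : h \in hs -> S h /\ m h \in hs.
  move=> /hsE[Hh|[y Hy <-]]; first by split; [exact: Hh.1|apply/hsE; right; exists h].
  have [Smy _ _ mmy] := mS y Hy.1 id.
  by split => //; rewrite mmy; apply/hsE; left.
have [p [e [e0 [ep eQ]]]] := cube_hole Smu.
have [s s0 sep] := finite_uniform_separation hs Smu.
pose r := Num.min e s / 4.
have m0 : 0 < Num.min e s by rewrite lt_min e0.
have r0 : 0 < r by rewrite /r; lra.
have re : 4 * r <= e by rewrite /r mulrC divfK ?ge_min ?lexx.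
have rs : 4 * r <= s by rewrite /r mulrC divfK ?ge_min ?lexx ?orbT.
(* A ball of radius [q] around [h + ones (2 * q)] misses [h] and stays within [3 * q] of it in sup
   norm. The factor [n] comes from [enorm_le_norm] and brings the Euclidean distance below [r]. *)
pose q := r / (3 * n%:R).
have nR : (1 : R) <= n%:R by rewrite ler1n.
have q0 : 0 < q by rewrite divr_gt0// mulr_gt0// (lt_le_trans ltr01).
have qn : 3 * q * n%:R = r.
  by rewrite /q; field; rewrite gt_eqF// (lt_le_trans ltr01).
have q3r : 3 * q <= r.
  by rewrite -[leRHS]qn ler_peMr// mulr_ge0// ltW.
pose cs := p :: [seq h + ones (2 * q) | h <- hs].
exists (size cs); apply: (insertions_balls (@measurable_unmatched R n) q0).
case=> [|x vs] /=; first by [].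
move=> /andP[xp].
rewrite all2E size_map => /andP[/eqP szv /allP near0].
have near i : (i < size hs)%N ->
     [/\ `|nth 0 vs i - nth 0 hs i| < r, enorm (nth 0 vs i - nth 0 hs i) < r &
         nth 0 vs i <> nth 0 hs i].
  move=> ih; set h := nth 0 hs i; set v := nth 0 vs i.
  have near1 : `|v - (h + ones (2 * q))| < q.
    apply: (near0 (h + ones (2 * q), v)).
    have -> : (h + ones (2 * q), v) =
        nth (0, 0) (zip [seq h + ones (2 * q) | h <- hs] vs) i.
      by rewrite nth_zip ?size_map//= (nth_map 0).
    by rewrite mem_nth// size_zip size_map -szv minnn.
  have ones2 : `|ones (2 * q)| = 2 * q by rewrite norm_ones gtr0_norm// mulr_gt0.
  have vh : `|v - h| < 3 * q.
    have -> : v - h = v - (h + ones (2 * q)) + ones (2 * q).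
      by rewrite opprD addrA subrK.
    by rewrite (le_lt_trans (ler_normD _ _))// ones2; lra.
  split; first exact: lt_le_trans q3r.
    apply: (le_lt_trans (enorm_le_norm _)).
    by rewrite -qn mulrC ltr_pM2r// (lt_le_trans ltr01).
  move=> vE; move: near1; rewrite vE opprD addrA subrr sub0r normrN ones2.
  by lra.
have xpr : `|x - p| < r by apply: (lt_le_trans xp); lra.
have [uxvs dis [m' off']] : [/\ uniq (x :: vs), forall u, u \in x :: vs -> ~ S u &
    exists m', stable_matching_off edist (S `|` [set` x :: vs]) [set x] m'].
  apply: (@strand_stable S m hs vs x p r) => //.
  - exact: undup_uniq.
  - by move=> h y hh Sy yh; rewrite (le_trans rs)// sep.
  - by move=> y Sy; rewrite (le_trans re)// ep.
  - move=> y Sy; rewrite leNgt; apply: contra => lt; apply/hsE; left.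
    split => //; exists x; split => //; apply: eQ => /=; lra.
have Smu' := points_add_seq Smu uxvs dis.
have -> : foldl (@add_point R n) (add_point mu x) vs =
  foldl (@add_point R n) mu (x :: vs) by [].
apply/(unmatchedP Smu'); exists x; first by right; rewrite /= inE eqxx.
move=> y k c; have [] := certified_sound (@enormC R n) _ off' c.
  by move=> u v -> ->.
by move=> /(_ erefl).
Qed.

End insertion_strands.

(** * Nonemptiness and conclusion *)

Section nonempty.
Context {R : realType} {n : nat} {dO : measure_display}.
Context {Omega : measurableType dO} (P : probability Omega R).
Context (X : Omega -> measures (Rd R n) R).
Local Notation Q := (@half_open_cube R n).
Hypothesis X_pp : Rd_point_process X.

Lemma ae_cube_empty_integral : {ae P, forall w x, support (X w) x -> ~ Q x} ->
  (\int[P]_w X w Q = 0)%E.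
Proof.
move=> empty; rewrite -(integral0 P setT).
have mQ := measurable_eval_process X_pp (@measurable_half_open_cube R n).
apply: ge0_ae_eq_integral => //; apply: filterS empty => w empty _ /=.
apply: (points_mass0 (point_configP (X_pp.2 w)) (@measurable_half_open_cube R n)).
by apply/seteqP; split => // x [Sx Qx]; exact: empty Qx.
Qed.

(** Having no points is a translation-invariant event, and probability 1 for it would force zero
    intensity. Deletion needs this because some point must always be available to delete. *)
Lemma ergodic_nonempty : ergodic P X -> (\int[P]_w X w Q)%E != 0%E ->
  {ae P, forall w, support (X w) !=set0}.
Proof.
move=> [_ erg] Q0.
pose A : set (measures (Rd R n) R) := [set mu | mu setT = 0%E].
have mA : measurable A.
  have := @measurable_eval R n setT measurableT measurableT _ (emeasurable_set1 0%E).
  by rewrite setTI.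
have inv t (mu : measures (Rd R n) R) : point_config mu ->
    (A (translate t mu) <-> A mu).
  by move=> _; rewrite /A /= /translate_fun /pushforward preimage_setT.
have mXA : measurable (X @^-1` A).
  by have := X_pp.1 measurableT _ mA; rewrite setTI.
have empty w : A (X w) -> forall x, ~ support (X w) x.
  move=> A0 x Sx.
  have := points_mass_ge1 (point_configP (X_pp.2 w)) measurableT Sx I.
  by rewrite A0 lee_fin ler10.
case: (erg A mA inv) => PA.
  apply: filterS (measure0_ae_not mXA PA) => w nA.
  apply/set0P/eqP => S0; apply: nA.
  apply: (points_mass0 (point_configP (X_pp.2 w)) measurableT).
  by rewrite S0 set0I.
exfalso; move/eqP: Q0; apply; apply: ae_cube_empty_integral.
have : P (~` (X @^-1` A)) = 0%E by rewrite probability_setC// PA subee.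
move=> /(measure0_ae_not (measurableC mXA)); apply: filterS => w /contrapT.
by move=> /empty h x /h.
Qed.

End nonempty.

Theorem theorem7 (R : realType) (n : nat) (n_gt0 : (0 < n)%N)
    (dO : measure_display) (Omega : measurableType dO)
    (P : probability Omega R)
    (X : Omega -> measures (Rd R n) R) (X_pp : Rd_point_process X)
    (X_inv : translation_invariant P X) (X_erg : ergodic P X)
    (X_int : (0 < intensity P X < +oo)%E)
    (X_noneq : {ae P, forall w, non_equidistant (X w)})
    (X_chain : {ae P, forall w, ~ has_descending_chain (X w)})
    (X_tol : insertion_tolerant P X \/ deletion_tolerant P X)
    (M : Omega -> measures (upair R n) R)
    (M_stable : stable_matching_scheme P X M)
    (dS : measure_display) (Omegas : measurableType dS)
    (Ps : probability Omegas R) (D : {RV Ps >-> R})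
    (D_cdf : forall r : R, 0 <= r ->
      Ps [set w | D w <= r] = (typical_distance_cdf P X M r)%:E) :
  ('E_Ps[(fun w => D w ^+ n)%R] = +oo)%E.
Proof.
have X_int' : (intensity P X < +oo)%E by case/andP: X_int.
have good := ae_matched_at X_pp X_noneq X_chain M_stable.
have U0 := unmatched_null X_pp good.
have lam0 := cube_intensity_gt0 D_cdf.
apply: contrapT => ED.
(* A nonnegative version of the integrand, equal to it almost surely: if its integral were infinite,
   so would be the expectation. *)
pose Dn (w : Omegas) : \bar R := (Num.max 0 (D w) ^+ n)%:E.
have D_moment : (\int[Ps]_w Dn w < +oo)%E.
  rewrite ltey; apply/eqP => Dinf; apply: ED; rewrite unlock -Dinf.
  apply: ae_eq_integral => //.
  - exact/measurable_EFinP/measurable_funX.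
  - exact/measurable_EFinP/measurable_funX/measurable_maxr.
  - apply: filterS (D_gt0 good D_cdf) => w w0 _.
    by rewrite /Dn (max_idPr (ltW w0)).
(* [pickle_inv] decodes only genuine codes, so each lattice point has exactly one index. *)
pose g : nat -> option 'rV[int]_n := pickle_inv.
have g_inj i j k : g i = Some k -> g j = Some k -> i = j.
  move=> gi gj; have gK := @pickle_invK 'rV[int]_n.
  by have := gK i; have := gK j; rewrite -/(g i) -/(g j) gi gj /= => <- <-.
have g_onto k : exists j, g j = Some k.
  by exists (pickle k); exact: pickleK_inv.
have fin := ae_finitely_many_competitors X_pp good X_inv X_int' D_cdf D_moment
  g_inj g_onto.
case: X_tol => [X_ins|X_del].
  have := ae_inserted_not_unmatched X_pp X_ins U0.
  move=> /(filterI (filterI good fin)) ae_false.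
  have : P setT = 0%E.
    apply: ae_not_measure0 => //; apply: filterS ae_false.
    move=> w [[[off _] finw] nins] _.
    have [k] := insertion_unmatched n_gt0 (point_configP (X_pp.2 w)) off finw.
    exact: nins.
  by rewrite [LHS]probability_setT => /eqP; rewrite eqe oner_eq0.
have Q0 : (\int[P]_w X w (@half_open_cube R n))%E != 0%E.
  by apply/eqP => Q0; move: lam0; rewrite Q0 ltxx.
have nonempty := ergodic_nonempty X_pp X_erg Q0.
(* Any point of [X] in the cube could be stranded by deletions, so the cube is almost surely empty,
   against positive intensity. *)
move/eqP: Q0; apply; apply: ae_cube_empty_integral => //.
have := ae_deleted_not_unmatched X_pp nonempty X_del U0.
move=> /(filterI (filterI good fin)); apply: filterS.
move=> w [[[off _] finw] ndel] x Sx Qx.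
have finx : finite_set [set y | support (X w) y /\
    enorm (y - x) < enorm (y - partner (M w) y)].
  by apply: sub_finite_set finw => y [Sy lt]; split => //; exists x.
have [s] := deletion_unmatched (point_configP (X_pp.2 w)) off Sx finx.
exact: ndel.
Qed.
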